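(* Let $d\ge 1$ and $n\ge 1$ be integers. Using the averaging theory of first order, for $|\varepsilon|\neq 0$ sufficiently small, the maximum number of limit cycles of the polynomial differential system $$\dot x=-y+\varepsilon P_a(x,y,z),\qquad \dot y=x+\varepsilon P_b(x,y,z),\qquad \dot z_\ell=\varepsilon P_{c_\ell}(x,y,z)\quad(\ell=1,\dots,d),$$ with $(x,y,z)\in\mathbb{R}\times\mathbb{R}\times\mathbb{R}^d$ and $P_a,P_b,P_{c_1},\dots,P_{c_d}$ real polynomials of degree at most $n$, that bifurcate from the periodic orbits of the system with $\varepsilon=0$ is at most $n^d(n-1)/2$, and this number is reached. Explicitly, with the averaged function $f:(0,\infty)\times\mathbb{R}^d\to\mathbb{R}^{d+1}$ defined in the context: (1) for every choice of real polynomials $P_a,P_b,P_{c_1},\dots,P_{c_d}$ of degree at most $n$, the function $f$ has at most $n^d(n-1)/2$ simple zeros in $(0,\infty)\times\mathbb{R}^d$; (2) there is a choice of such polynomials for which $f$ has exactly $n^d(n-1)/2$ simple zeros in $(0,\infty)\times\mathbb{R}^d$ and, for all $\varepsilon\ne0$ with $|\varepsilon|$ sufficiently small, the system has $n^d(n-1)/2$ distinct limit cycles, one for each simple zero $(r^*,z^* )$, converging as $\varepsilon\to0$ to the periodic orbit $\{x^2+y^2=(r^* )^2,\ z=z^*\}$ of the unperturbed system.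
   Context: For $\varepsilon=0$ the system is $\dot x=-y,\ \dot y=x,\ \dot z=0$, whose orbits are the equilibria $(0,0,z)$ and the periodic orbits $\{x^2+y^2=r^2,\ z=\text{const}\}$ with $r>0$. A limit cycle is a periodic orbit that is isolated in the set of all periodic orbits of the system. ''Polynomial of degree $n$'' means a polynomial of the form $\sum_{i+j+k_1+\dots+k_d\le n} a_{ijk}x^iy^jz_1^{k_1}\cdots z_d^{k_d}$, with arbitrary real coefficients. Averaged function of first order: in the coordinates $x=r\cos\theta$, $y=r\sin\theta$, $z=z$ with $r>0$, taking $\theta$ as the new independent variable, the system becomes $r'=\varepsilon F_1(\theta,r,z)+O(\varepsilon^2)$, $z_\ell'=\varepsilon F_{\ell+1}(\theta,r,z)+O(\varepsilon^2)$, where $$F_1(\theta,r,z)=\cos\theta\,P_a(r\cos\theta,r\sin\theta,z)+\sin\theta\,P_b(r\cos\theta,r\sin\theta,z),$$ $$F_{\ell+1}(\theta,r,z)=P_{c_\ell}(r\cos\theta,r\sin\theta,z),\quad \ell=1,\dots,d.$$ The averaged function is $f=(f_1,\dots,f_{d+1})$ with $f_m(r,z)=\int_0^{2\pi}F_m(\theta,r,z)\,d\theta$ for $m=1,\dots,d+1$. A zero $p$ of $f$ is simple if the Jacobian determinant of $f$ at $p$ is nonzero. The limit cycles obtained ''using the averaging theory of first order'' are those associated with the simple zeros $(r^*,z^* )$ of $f$ with $r^*>0$: each such zero yields, for $|\varepsilon|\ne0$ small, a $2\pi$-periodic (in $\theta$) solution $(r(\theta,\varepsilon),z(\theta,\varepsilon))$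 with $(r(0,\varepsilon),z(0,\varepsilon))\to(r^*,z^* )$ as $\varepsilon\to0$. *)

(* Defs.v *)
(* World: MathComp-Analysis.  Only the canonical structures and coercions of
   [mpoly] are imported: its notations clash with those of MathComp-Analysis. *)
From HB Require Import structures.
From mathcomp Require Import all_boot all_order all_algebra.
From mathcomp Require Import all_classical all_reals all_analysis.
From mathcomp Require mpoly.
Import (canonicals, coercions) mpoly.

Set Implicit Arguments.
Unset Strict Implicit.
Unset Printing Implicit Defensive.
Import Order.TTheory GRing.Theory Num.Theory.
Import numFieldNormedType.Exports.
Local Open Scope classical_set_scope.
Local Open Scope ring_scope.

Definition vcons (R : realType) (m : nat) (x : R) (v : 'rV[R]_m) : 'rV[R]_m.+1 :=
  row_mx x%:M v.

Definition vhead (R : realType) (m : nat) (v : 'rV[R]_m.+1) : R := v 0 ord0.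

Definition vtail (R : realType) (m : nat) (v : 'rV[R]_m.+1) : 'rV[R]_m :=
  col' ord0 v.

(* Points of the phase space are row vectors (x, y, z_1, ..., z_d); points of
   the (r, z)-space are row vectors (r, z_1, ..., z_d).  The variables of the
   polynomials are numbered as the coordinates of the phase space. *)
Record perturbation (R : realType) (d : nat) := Perturbation {
  pert_a : mpoly.mpoly d.+2 R;
  pert_b : mpoly.mpoly d.+2 R;
  pert_c : 'I_d -> mpoly.mpoly d.+2 R }.

(* [msize] is the total degree plus one, and 0 on the zero polynomial. *)
Definition deg_le (R : realType) (k n : nat) (p : mpoly.mpoly k R) : Prop :=
  (mpoly.msize p <= n.+1)%N.

Definition pert_deg_le (R : realType) (d n : nat) (P : perturbation R d) : Prop :=
  [/\ deg_le n (pert_a P), deg_le n (pert_b P)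
    & forall l, deg_le n (pert_c P l)].

Definition peval (R : realType) (k : nat) (p : mpoly.mpoly k R) (q : 'rV[R]_k) : R :=
  mpoly.meval (fun i => q 0 i) p.

Definition vfield (R : realType) (d : nat) (P : perturbation R d) (e : R)
    (q : 'rV[R]_d.+2) : 'rV[R]_d.+2 :=
  vcons (- vhead (vtail q) + e * peval (pert_a P) q)
    (vcons (vhead q + e * peval (pert_b P) q)
      (\row_(l < d) (e * peval (pert_c P l) q))).

Definition is_solution (R : realType) (m : nat) (X : 'rV[R]_m -> 'rV[R]_m)
    (g : R -> 'rV[R]_m) : Prop :=
  forall t : R, is_derive t 1 g (X (g t)).

(* Equilibria are not periodic orbits. *)
Definition periodic_orbit (R : realType) (m : nat) (X : 'rV[R]_m -> 'rV[R]_m)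
    (O : set 'rV[R]_m) : Prop :=
  exists g : R -> 'rV[R]_m,
    [/\ is_solution X g,
        exists2 T : R, 0 < T & forall t, g (t + T) = g t,
        exists t, g t != g 0
      & O = range g].

(* Isolation is in the sense of periodic orbits as sets: some neighbourhood of
   the orbit contains no other periodic orbit.  Other periodic orbits may
   still enter that neighbourhood and leave it. *)
Definition limit_cycle (R : realType) (m : nat) (X : 'rV[R]_m -> 'rV[R]_m)
    (O : set 'rV[R]_m) : Prop :=
  periodic_orbit X O /\
  exists U : set 'rV[R]_m,
    [/\ open U, O `<=` U
      & forall O', periodic_orbit X O' -> O' `<=` U -> O' = O].

Definition cyl (R : realType) (d : nat) (theta : R) (v : 'rV[R]_d.+1) : 'rV[R]_d.+2 :=
  vcons (vhead v * cos theta) (vcons (vhead v * sin theta) (vtail v)).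

Definition first_order (R : realType) (d : nat) (P : perturbation R d)
    (theta : R) (v : 'rV[R]_d.+1) : 'rV[R]_d.+1 :=
  let q := cyl theta v in
  vcons (cos theta * peval (pert_a P) q + sin theta * peval (pert_b P) q)
    (\row_(l < d) peval (pert_c P l) q).

Definition averaged (R : realType) (d : nat) (P : perturbation R d)
    (v : 'rV[R]_d.+1) : 'rV[R]_d.+1 :=
  \row_(i < d.+1)
    \int[lebesgue_measure]_(theta in `[0, 2 * pi]) (first_order P theta v 0 i).

Definition simple_zeros (R : realType) (d : nat) (f : 'rV[R]_d.+1 -> 'rV[R]_d.+1) :
    set 'rV[R]_d.+1 :=
  [set p | [/\ 0 < vhead p, f p = 0 & \det (jacobian f p) != 0]].

(* d(theta)/dt = (x y' - y x') / r^2 along the system, in cylindrical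
   coordinates. *)
Definition angular_speed (R : realType) (d : nat) (P : perturbation R d) (e : R)
    (theta : R) (v : 'rV[R]_d.+1) : R :=
  let q := cyl theta v in
  1 + e * (cos theta * peval (pert_b P) q - sin theta * peval (pert_a P) q)
          / vhead v.

(* Since dr/dt = e F_1 and dz_l/dt = e F_(l+1), dividing by the angular speed
   gives the system with theta as independent variable.  It is equivalent to
   the original one only where r > 0 and the angular speed is positive; both
   are required, and they also rule out the division by zero. *)
Definition polar_periodic_solution (R : realType) (d : nat) (P : perturbation R d)
    (e : R) (w : R -> 'rV[R]_d.+1) : Prop :=
  forall theta : R,
    [/\ 0 < vhead (w theta),
        0 < angular_speed P e theta (w theta),
        w (theta + 2 * pi) = w theta
      & is_derive theta 1 w
          ((e / angular_speed P e theta (w theta)) *: first_order P theta (w theta))].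

Definition polar_orbit (R : realType) (d : nat) (w : R -> 'rV[R]_d.+1) :
    set 'rV[R]_d.+2 :=
  range (fun theta => cyl theta (w theta)).

Definition unperturbed_orbit (R : realType) (d : nat) (p : 'rV[R]_d.+1) :
    set 'rV[R]_d.+2 :=
  [set q | vhead q ^+ 2 + vhead (vtail q) ^+ 2 = vhead p ^+ 2 /\
           vtail (vtail q) = vtail p].

(* Convergence in the Hausdorff distance, as e tends to 0 with e != 0. *)
Definition hausdorff_cvg0 (R : realType) (m : nat) (K : R -> set 'rV[R]_m)
    (L : set 'rV[R]_m) : Prop :=
  forall delta : R, 0 < delta ->
    \forall e \near (0 : R)^',
      K e `<=` \bigcup_(q in L) ball q delta /\
      L `<=` \bigcup_(q in K e) ball q delta.

(* Main.v *)
Require Import Defs.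
From mathcomp Require Import all_boot all_order all_algebra.
From mathcomp Require Import all_classical all_reals all_analysis.
From mathcomp Require Import zify ring lra.
From mathcomp Require mpoly.
Import -(notations) mpoly.
Set Implicit Arguments.
Unset Strict Implicit.
Unset Printing Implicit Defensive.
Import Order.TTheory GRing.Theory Num.Theory.
Import numFieldNormedType.Exports.
Local Open Scope classical_set_scope.
Local Open Scope card_scope.
Local Open Scope ring_scope.

(** Averaging kills every monomial whose exponent of [cos] or of [sin] is odd. Hence the first
    averaged component is [r] times a polynomial of degree at most [n - 1] in [(r, z)], the
    others are polynomials of degree at most [n], and all of them are even in [r]. After the
    factor [r] is removed, the [d + 1] polynomials have at most [(n - 1) * n ^ d] nondegenerate
    common zeros by Bezout's theorem, and the reflection [r -> - r] matches those with [r > 0]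
    with those with [r < 0], which gives half of that number.

    [bezout] is proved over any real field by counting dimensions. Let [D] be the product of
    the degrees of the equations [G_k = 0], let [p_0, ..., p_m] be nondegenerate common zeros,
    and let [h_j] be a polynomial that vanishes at every [p_i] with [i != j] but not at [p_j].
    The products [G ^ a * h_j] with [sum_k D_k * a_k <= M] lie in the space of polynomials of
    degree at most [M + e], for a constant [e]; their number is at least [(m + 1) / D] times
    the number of monomials of degree at most [M]. So if [m + 1 > D] they are linearly
    dependent for some [M]. The part of lowest order of such a relation at [p_j] is a
    polynomial that vanishes on the image of the differential of [G] at [p_j]. This image is
    the whole space, so that the part is zero: a contradiction.

    For the converse, take [P_a = x * g], [P_b = y * g] with [g] and the [P_c] functions of
    [s = x ^ 2 + y ^ 2] and [z]. Then the averaged field is, up to [2 * pi], the perturbation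
    itself written in the coordinates [(r, z)], the angular speed is [1], and each zero of it is
    an exact periodic orbit, whatever [e] is. With products of linear factors [b] (in [s], of
    degree [n / 2] rounded down) and [c_l] (in [z_l]) one takes
    - for odd [n]: [g = b s] and [P_c_l = c_l z_l], all [c_l] of degree [n];
    - for even [n]: [g = c_0 z_0], [P_c_0 = c_0 z_0 + b s] with [c_0] of degree [n - 1], and
      [P_c_l = c_l z_l] of degree [n] for the other [l].
    In both cases the zeros form a grid of [n ^ d * (n - 1) / 2] points, all simple.

    A zero of the averaged field can be a center of the field, so that isolation of the orbit is
    not automatic; the term [c_0 z_0] in the even case is there to prevent this. It makes the
    function [lyapunov] monotone along the flow, with derivative [e] times a sum of squares.
    On a periodic orbit that stays close to a given one all these squares are therefore zero,
    which forces [s] and [z] to be constant and the orbit to be the given one. *)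

(** * Exponential growth *)

(** By Bernoulli's inequality the ratio of the two powers at least doubles each time that [k] grows
    by [D], so the witness is [D] times a large power of two. *)
Lemma exp_beats_poly D e N : exists k, (D ^ k * (k * e + 1) ^ N < D.+1 ^ k)%N.
Proof.
case: D => [|D]; first by exists 1%N; rewrite expn1 mul0n.
set E := D.+1; set K := (E * e + 1)%N.
have bernoulli k : (E ^ k * (E + k) <= E * E.+1 ^ k)%N.
  elim: k => [|k IHk]; first by rewrite !expn0; lia.
  have := leq_mul IHk (leqnn E.+1).
  rewrite !expnS [(E * (E.+1 * _))%N]mulnCA [(E.+1 * (E * _))%N]mulnC; apply: leq_trans.
  by rewrite -[leqRHS]mulnA [(E * E ^ k)%N]mulnC -mulnA leq_mul2l; nia.
have two : (2 * E ^ E <= E.+1 ^ E)%N.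
  have := bernoulli E; rewrite addnn -mul2n mulnA mulnC leq_pmul2l//; lia.
have twoq q : (2 ^ q * E ^ (E * q) <= E.+1 ^ (E * q))%N.
  by case: q => [|q]; rewrite ?muln0// !expnM -expnMn leq_exp2r.
pose u := (2 * N + K * N + 1)%N; pose s := (2 * u)%N.
exists (E * 2 ^ s)%N.
apply: leq_trans (twoq _); rewrite mulnC ltn_pmul2r ?expn_gt0//.
have u2 : (u < 2 ^ u)%N by exact: ltn_expl.
have sN : ((K + s) * N < 2 ^ s)%N.
  by rewrite /s mul2n -addnn expnD; nia.
have base : (E * 2 ^ s * e + 1 <= 2 ^ (K + s))%N.
  rewrite expnD; have : (K < 2 ^ K)%N by exact: ltn_expl.
  have : (0 < 2 ^ s)%N by rewrite expn_gt0.
  rewrite /K; move: (2 ^ s)%N (2 ^ K)%N => a b; nia.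
apply: (@leq_ltn_trans (2 ^ ((K + s) * N))).
  by case: (N) => [|N']; rewrite ?muln0// expnM leq_exp2r.
by rewrite ltn_exp2l.
Qed.

(** * Linear dependence *)

Section LinearDependence.
Variable F : fieldType.

Lemma linear_dependence (I J : finType) (A : I -> J -> F) : (#|J| < #|I|)%N ->
  exists2 c : I -> F, exists i, c i != 0 & forall j, \sum_i c i * A i j = 0.
Proof.
move=> JI; pose M := \matrix_(i < #|I|, j < #|J|) A (enum_val i) (enum_val j).
have : kermx M != 0.
  rewrite -mxrank_eq0 mxrank_ker -lt0n subn_gt0.
  exact: leq_ltn_trans (rank_leq_col M) JI.
case/rowV0Pn=> v /sub_kermxP vM v0.
exists (fun i => v 0 (enum_rank i)).
  have [i vi|v_eq0] := pickP (fun i => v 0 i != 0).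
    by exists (enum_val i); rewrite enum_valK.
  case/negP: v0; apply/eqP/rowP => i; rewrite mxE.
  by apply/eqP/negbNE; rewrite v_eq0.
move=> j; have := congr1 (fun B : 'rV_#|J| => B 0 (enum_rank j)) vM.
rewrite [LHS]mxE [RHS]mxE; apply: etrans.
rewrite (reindex_onto enum_val enum_rank) /=; last by move=> i _; rewrite enum_rankK.
rewrite (eq_bigl predT); last by move=> i; rewrite enum_valK eqxx.
by apply: eq_bigr => i _; rewrite !mxE enum_valK enum_rankK.
Qed.

End LinearDependence.

(** * Monomials of bounded weighted degree *)

Section MonomialCount.
Variable N : nat.

Lemma card_bmultinom_le M : (#|{: bmultinom N M.+1}| <= (M + 1) ^ N)%N.
Proof.
have lt_deg (a : bmultinom N M.+1) i : (a i < M.+1)%N.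
  by apply: leq_ltn_trans (bmdeg a); rewrite mdegE (bigD1 i)//= leq_addr.
pose f (a : bmultinom N M.+1) := [ffun i => Ordinal (lt_deg a i)].
apply: leq_trans (leq_card f _) _; last by rewrite card_ffun !card_ord addn1.
move=> a b /ffunP fab; apply/val_inj/mnmP => i.
by have := congr1 val (fab i); rewrite !ffunE.
Qed.

Definition wdeg (D : 'I_N -> nat) (a : multinom N) := (\sum_i D i * a i)%N.

(** Dividing every exponent by the corresponding weight sends a monomial of degree at most [M]
    to one of weighted degree at most [M]; the remainders tell the preimages apart. *)
Lemma card_bmultinom_weighted (D : 'I_N -> nat) M : (forall i, 0 < D i)%N ->
  (#|{: bmultinom N M.+1}| <=
     #|{: {a : bmultinom N M.+1 | (wdeg D a <= M)%N}}| * \prod_i D i)%N.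
Proof.
move=> D0.
pose quo (b : multinom N) := Multinom [tuple (b i %/ D i)%N | i < N].
have quoE b i : quo b i = (b i %/ D i)%N by rewrite multinomE tnth_mktuple.
have quoM b : (wdeg D (quo b) <= mdeg b)%N.
  by rewrite mdegE leq_sum// => i _; rewrite quoE mulnC leq_divM.
have quo_deg b : (mdeg (quo b) <= mdeg b)%N.
  by rewrite !mdegE leq_sum// => i _; rewrite quoE leq_div.
have bd (b : bmultinom N M.+1) : (mdeg (quo b) < M.+1)%N.
  exact: leq_ltn_trans (quo_deg b) (bmdeg b).
have wd (b : bmultinom N M.+1) : (wdeg D (BMultinom (bd b)) <= M)%N.
  by apply: leq_trans (quoM b) _; rewrite -ltnS bmdeg.
have rd (b : bmultinom N M.+1) i : (b i %% D i < D i)%N by rewrite ltn_mod D0.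
pose rem (b : bmultinom N M.+1) : {dffun forall i, 'I_(D i)} :=
  [ffun i => Ordinal (rd b i)].
pose f b : {a : bmultinom N M.+1 | (wdeg D a <= M)%N} * {dffun forall i, 'I_(D i)} :=
  (exist (fun a : bmultinom N M.+1 => (wdeg D a <= M)%N) (BMultinom (bd b)) (wd b),
   rem b).
suff /leq_card : injective f.
  rewrite card_prod card_dep_ffun foldrE big_map.
  by under eq_bigr do rewrite card_ord; rewrite big_enum.
move=> a b fab; have /ffunP rab : rem a = rem b by exact: (congr1 snd fab).
have qab i : quo a i = quo b i.
  by have := congr1 (fun x => bmnm (val x.1)) fab => /= ->.
apply/val_inj/mnmP => i; rewrite /= (divn_eq (a i) (D i)) (divn_eq (b i) (D i)).
rewrite -!quoE qab; congr addn.
by have := congr1 val (rab i); rewrite !ffunE.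
Qed.

End MonomialCount.

(** The shift by [e] costs nothing in the long run: the number of monomials of degree at most
    [M] grows polynomially in [M], so it cannot be multiplied by a fixed factor greater than one
    each time that [M] increases by [e]. *)
Lemma bmultinom_count N (D : 'I_N -> nat) e : (forall i, 0 < D i)%N ->
  exists M, (#|{: bmultinom N (M + e).+1}| <
    (\prod_i D i).+1 * #|{: {a : bmultinom N M.+1 | (wdeg D a <= M)%N}}|)%N.
Proof.
move=> D0; set P := (\prod_i D i)%N.
have P0 : (0 < P)%N by rewrite prodn_gt0.
pose C M := #|{: bmultinom N M.+1}|; pose A M := #|{: {a : bmultinom N M.+1 | (wdeg D a <= M)%N}}|.
have [k lt_k] := exp_beats_poly P e N.
suff [M CA] : exists M, (P * C (M + e) < P.+1 * C M)%N.
  exists M; rewrite -(ltn_pmul2l P0); apply: leq_trans CA _.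
  by rewrite mulnCA leq_mul2l mulnC card_bmultinom_weighted ?orbT.
(* Otherwise [C] grows geometrically along the multiples of [e]. *)
have [i lt_i|geom] := pickP (fun i : 'I_k => (P * C (i * e + e) < P.+1 * C (i * e))%N).
  by exists (i * e)%N.
have : (P.+1 ^ k <= P ^ k * C (k * e))%N.
  elim: {-2}k (leqnn k) => [|j IHj] ltjk.
    by rewrite !expn0 mul1n mul0n; apply/card_gt0P; exists (@bm0 N 0).
  have /negbT := geom (Ordinal ltjk); rewrite -leqNgt /= -mulSnr => le_j.
  rewrite expnS; apply: (@leq_trans (P.+1 * (P ^ j * C (j * e)))).
    by rewrite leq_mul2l IHj ?orbT// ltnW.
  by rewrite mulnCA expnSr -mulnA leq_mul2l le_j orbT.
move=> le_k; have := leq_trans lt_k le_k.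
rewrite ltn_pmul2l ?expn_gt0 ?P0// ltnNge.
by rewrite card_bmultinom_le.
Qed.

(** * Polynomials that vanish everywhere *)

Section Vanishing.
Variables (R : numFieldType).

Lemma poly_vanishing (q : {poly R}) : (forall k : nat, q.[k%:R] = 0) -> q = 0.
Proof.
move=> q0; apply/eqP; apply: contraT => qn0.
have := max_poly_roots (rs := [seq k%:R | k <- iota 0 (size q)]) qn0.
rewrite size_map size_iota ltnn => -> //.
  by apply/allP => _ /mapP[k _ ->]; apply/eqP/q0.
by rewrite map_inj_uniq ?iota_uniq// => a b /eqP; rewrite eqr_nat => /eqP.
Qed.

Lemma digits_inj (K N : nat) (a b : 'I_N -> nat) :
  (forall i, a i < K)%N -> (forall i, b i < K)%N ->
  (\sum_i a i * K ^ i = \sum_i b i * K ^ i)%N -> a =1 b.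
Proof.
elim: N a b => [|N IHN] a b aK bK; first by move=> _ [].
have shift (c : 'I_N.+1 -> nat) : (\sum_(i < N.+1) c i * K ^ i =
    (\sum_(i < N) c (lift ord0 i) * K ^ i) * K + c ord0)%N.
  rewrite big_ord_recl expn0 muln1 addnC; congr addn.
  by rewrite big_distrl/=; apply: eq_bigr => i _; rewrite -mulnA -expnSr.
rewrite !shift => E.
have K0 : (0 < K)%N by apply: leq_ltn_trans (aK ord0).
have E0 : a ord0 = b ord0.
  by have := congr1 (modn^~ K) E; rewrite /= !modnMDl !modn_small.
move: E; rewrite E0 => /addIn/eqP; rewrite eqn_pmul2r// => /eqP E.
move=> i; case: (unliftP ord0 i) => [j ->|->//].
exact: (IHN (fun j => a (lift ord0 j)) (fun j => b (lift ord0 j))).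
Qed.

(** Kronecker substitution: [u_i = t ^ (K ^ i)], with [K] larger than every exponent, keeps
    the monomials apart, which reduces the claim to one variable. *)
Lemma mpoly_vanishing N (q : mpoly.mpoly N R) :
  (forall u : 'I_N -> R, meval u q = 0) -> q = 0.
Proof.
move=> q0; pose K := mmeasure mdeg q.
pose code (m : multinom N) := (\sum_i m i * K ^ i)%N.
pose Q : {poly R} := \sum_(m <- msupp q) mcoeff m q *: 'X^(code m).
have Q0 : Q = 0.
  apply: poly_vanishing => t; rewrite -(q0 (fun i => t%:R ^+ (K ^ i))).
  rewrite mevalE horner_sum; apply: eq_bigr => m _; rewrite hornerZ hornerXn.
  congr (_ * _); rewrite expr_sum; apply: eq_bigr => i _.
  by rewrite mulnC exprM.
apply/mpolyP => m; rewrite mcoeff0; apply/eqP; rewrite mcoeff_eq0.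
apply/negP => mq; have : Q`_(code m) = 0 by rewrite Q0 coef0.
rewrite coef_sum (bigD1_seq m)//= ?msupp_uniq// coefZ coefXn eqxx mulr1.
rewrite big_seq_cond big1 ?addr0; last first.
  move=> m' /andP[m'q m'm]; rewrite coefZ coefXn; case: eqP => [E|]; last by rewrite mulr0.
  have lt_K (m0 : multinom N) i : m0 \in msupp q -> (m0 i < K)%N.
    move=> /msize_mdeg_lt; apply: leq_ltn_trans.
    by rewrite mdegE (bigD1 i)//= leq_addr.
  case/eqP: m'm; apply/mnmP.
  by apply: (digits_inj (K := K) _ _ (esym E)) => i; apply: lt_K.
by apply/eqP; rewrite -mcoeff_msupp.
Qed.

End Vanishing.
(** * Bezout's bound for nondegenerate zeros *)

Section Bezout.
Variables (R : realFieldType) (N : nat).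
Implicit Types (p v u : 'I_N -> R) (q : mpoly.mpoly N R).

(** The restriction of a polynomial to the line [t |-> p + t * v], as a polynomial in [t]: its
    coefficient of index 1 is the derivative at [p] in the direction [v]. *)
Definition line p v : mpoly.mpoly N R -> {poly R} :=
  mmap polyC (fun i => (p i)%:P + v i *: 'X).

Lemma horner_line p v q t : (line p v q).[t] = meval (fun i => p i + t * v i) q.
Proof.
rewrite /line /mmap mevalE horner_sum; apply: eq_bigr => a _.
rewrite hornerM hornerC; congr (_ * _); rewrite horner_prod.
by apply: eq_bigr => i _; rewrite horner_exp !hornerE mulrC.
Qed.

Lemma line_coef0 p v q : (line p v q)`_0 = meval p q.
Proof.
by rewrite -horner_coef0 horner_line; apply: meval_eq => i; rewrite mul0r addr0.
Qed.

Lemma msizeM_leq q1 q2 a b : (mmeasure mdeg q1 <= a.+1)%N ->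
  (mmeasure mdeg q2 <= b.+1)%N -> (mmeasure mdeg (q1 * q2) <= (a + b).+1)%N.
Proof.
have [->|q10] := eqVneq q1 0; first by rewrite mul0r mmeasure0.
have [->|q20] := eqVneq q2 0; first by rewrite mulr0 mmeasure0.
by rewrite msizeM//; move: (mmeasure _ q1) (mmeasure _ q2) => x y; lia.
Qed.

Lemma msize_prod_leq (I : Type) (r : seq I) (P : pred I) (F : I -> mpoly.mpoly N R) (d : I -> nat) :
  (forall i, P i -> mmeasure mdeg (F i) <= (d i).+1)%N ->
  (mmeasure mdeg (\prod_(i <- r | P i) F i) <= (\sum_(i <- r | P i) d i).+1)%N.
Proof.
move=> Fd; elim/big_ind2: _ => //; first by rewrite msize1.
by move=> q1 a q2 b; exact: msizeM_leq.
Qed.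

Lemma msizeXn_leq q a k : (mmeasure mdeg q <= a.+1)%N ->
  (mmeasure mdeg (q ^+ k) <= (a * k).+1)%N.
Proof.
move=> qa; rewrite -[k]card_ord -prodr_const.
have := @msize_prod_leq _ (index_enum (ordinal k)) predT (fun=> q) (fun=> a) (fun _ _ => qa).
by rewrite sum_nat_const card_ord mulnC.
Qed.

(** Sums of squares of differences of coordinates separate points over a real field without any
    choice of linear forms. *)
Definition separator m (p : 'I_m -> 'I_N -> R) j : mpoly.mpoly N R :=
  \prod_(i < m | i != j) \sum_k (mpolyX R (mnm1 k) - mpolyC N (p i k)) ^+ 2.

Lemma meval_separator m (p : 'I_m -> 'I_N -> R) j x :
  meval x (separator p j) = \prod_(i < m | i != j) \sum_k (x k - p i k) ^+ 2.
Proof.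
rewrite rmorph_prod; apply: eq_bigr => i _; rewrite rmorph_sum.
by apply: eq_bigr => k _; rewrite rmorphXn rmorphB/= mevalXU mevalC.
Qed.

Lemma separator_eq0 m (p : 'I_m -> 'I_N -> R) i j : i != j ->
  meval (p i) (separator p j) = 0.
Proof.
move=> ij; rewrite meval_separator (bigD1 i)//= big1 ?mul0r// => k _.
by rewrite subrr expr0n.
Qed.

Lemma separator_neq0 m (p : 'I_m -> 'I_N -> R) j :
  (forall i j, p i =1 p j -> i = j) -> meval (p j) (separator p j) != 0.
Proof.
move=> p_inj; rewrite meval_separator; apply/prodf_neq0 => i ij.
rewrite psumr_eq0; last by move=> k _; exact: sqr_ge0.
apply/negP => /allP eq_ji; case/eqP: ij; apply: p_inj => k.
have := eq_ji k (mem_index_enum k); rewrite /= sqrf_eq0 subr_eq0.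
by move=> /eqP ->.
Qed.

(** Nondegeneracy is the surjectivity of the differential of [G] at each zero. See the opening
    comment for the argument; orders of vanishing are measured along lines through the zero. *)
Theorem bezout m (p : 'I_m -> 'I_N -> R) (G : 'I_N -> mpoly.mpoly N R) (D : 'I_N -> nat) :
  (forall k, mmeasure mdeg (G k) <= (D k).+1)%N ->
  (forall i j, p i =1 p j -> i = j) ->
  (forall i k, meval (p i) (G k) = 0) ->
  (forall i u, exists v, forall k, (line (p i) v (G k))`_1 = u k) ->
  (m <= \prod_k D k)%N.
Proof.
move=> GD p_inj Gp surj; case: (posnP m) => [->//|m0].
(* A constant equation with a zero has a zero differential. *)
have D0 k : (0 < D k)%N.
  rewrite lt0n; apply/eqP => Dk; have := GD k; rewrite Dk => /msize1_polyC Gk.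
  have [v /(_ k)] := surj (Ordinal m0) (fun=> 1).
  by rewrite Gk /line mmapC coefC => /eqP; rewrite eq_sym oner_eq0.
rewrite leqNgt; apply/negP => Dm.
pose h := separator p; pose e := (\sum_j mmeasure mdeg (h j))%N.
have [M cols_rows] := bmultinom_count e D0.
pose W := {a : bmultinom N M.+1 | (wdeg D a <= M)%N}.
pose ex (x : 'I_m * W) : multinom N := val (val x.2).
pose term x := h x.1 * \prod_k G k ^+ ex x k.
have term_size x : (mmeasure mdeg (term x) <= (e + M).+1)%N.
  apply: msizeM_leq.
    by apply: leq_trans (leqnSn _); rewrite /e (bigD1 x.1)//= leq_addr.
  have wM : (wdeg D (ex x) <= M)%N := valP x.2.
  apply: (leq_trans _ (wM : (_ < M.+1)%N)).
  by apply: msize_prod_leq => k _; apply: msizeXn_leq.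
have [|c [x0 cx0] cE] := @linear_dependence R ('I_m * W)%type {: bmultinom N (M + e).+1}
    (fun x b => mcoeff (val b) (term x)).
  apply: leq_trans cols_rows _; rewrite card_prod card_ord leq_mul2r.
  by rewrite Dm orbT.
have relation : \sum_x c x *: term x = 0.
  apply/mpolyP => b; rewrite mcoeff0 raddf_sum/=.
  have [b_small|b_large] := ltnP (mdeg b) (M + e).+1.
    rewrite -[RHS](cE (BMultinom b_small)).
    by apply: eq_bigr => x _; rewrite mcoeffZ.
  rewrite big1// => x _; rewrite mcoeffZ memN_msupp_eq0 ?mulr0//.
  by apply: msize_mdeg_ge; apply: leq_trans (term_size x) _; rewrite addnC.
(* The lowest order [nu] at which a monomial in [G] occurs in the relation. *)
have [[j0 a0] c0 min_nu] :=
  @arg_minnP _ x0 (fun x => c x != 0) (fun x => mdeg (ex x)) cx0.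
set nu := mdeg (ex (j0, a0)) in min_nu.
pose q : mpoly.mpoly N R :=
  \sum_(a : W | mdeg (ex (j0, a)) == nu) c (j0, a) *: mpolyX R (ex (j0, a)).
suff q0 : q = 0.
  have := congr1 (mcoeff (ex (j0, a0))) q0; rewrite mcoeff0 raddf_sum/=.
  rewrite (bigD1 a0)//= mcoeffZ mcoeffX eqxx mulr1 big1 ?addr0.
    by move=> c00; rewrite c00 eqxx in c0.
  move=> a /andP[_ aa0]; rewrite mcoeffZ mcoeffX; case: eqP => [E|]; last by rewrite mulr0.
  by case/eqP: aa0; do 2!apply: val_inj.
apply: mpoly_vanishing => u; have [v vE] := surj j0 u.
(* Along the line, [G k] is [t * U k] with [U k] equal to [u k] at [t = 0]. *)
pose L := line (p j0) v; pose U k := drop_poly 1 (L (G k)).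
have LG k : L (G k) = U k * 'X.
  rewrite -[LHS](poly_take_drop 1) expr1 -[RHS]add0r; congr (_ + _).
  by apply/polyP => i; rewrite coef_take_poly coef0; case: i => //=; rewrite line_coef0 Gp.
have Lterm x : L (term x) = L (h x.1) * \prod_k U k ^+ ex x k * 'X^(mdeg (ex x)).
  rewrite /L /line rmorphM -mulrA; congr (_ * _).
  rewrite rmorph_prod mdegE expr_sum -big_split; apply: eq_bigr => k _.
  by rewrite rmorphXn /= [X in X ^+ _ = _](LG k) exprMn.
have Lterm_nu x : c x != 0 -> (L (term x))`_nu =
    if (mdeg (ex x) == nu) && (x.1 == j0)
    then meval (p j0) (h j0) * \prod_k u k ^+ ex x k else 0.
  move=> cx; rewrite Lterm coefMXn; have := min_nu x cx.
  rewrite leq_eqVlt eq_sym; case: eqP => [->|_] /= => [_|->//].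
  rewrite ltnn subnn -horner_coef0 hornerM horner_coef0 line_coef0.
  case: eqP => [->|/eqP xj0]; last by rewrite separator_eq0 1?eq_sym// mul0r.
  congr (_ * _); rewrite horner_prod; apply: eq_bigr => k _.
  by rewrite horner_exp horner_coef0 coef_drop_poly add0n vE.
have : (L (\sum_x c x *: term x))`_nu = 0 by rewrite relation /L /line rmorph0 coef0.
rewrite /L /line raddf_sum coef_sum.
rewrite (eq_bigr (fun x => if (mdeg (ex x) == nu) && (x.1 == j0)
   then c x * (meval (p j0) (h j0) * \prod_k u k ^+ ex x k) else 0)); last first.
  move=> x _; rewrite /= mmapZ coefCM -/(line _ _ _) -/(L _).
  have [->|cx] := eqVneq (c x) 0; first by rewrite !mul0r if_same.
  by rewrite Lterm_nu//; case: ifP; rewrite ?mulr0.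
rewrite -big_mkcond/=.
rewrite (reindex_onto (fun a : W => (j0, a)) snd)/=; last first.
  by move=> [j a] /= /andP[_ /eqP ->].
rewrite (eq_bigl (fun a : W => mdeg (ex (j0, a)) == nu)); last first.
  by move=> a; rewrite !eqxx !andbT.
move=> sum0; apply: (mulfI (separator_neq0 j0 p_inj)); rewrite mulr0 -[RHS]sum0.
rewrite /q raddf_sum mulr_sumr; apply: eq_bigr => a _.
by rewrite /= mevalZ mevalX mulrCA.
Qed.

End Bezout.

(** * Differentials of polynomial maps *)

Section PolynomialMaps.
Variables (R : realType) (N : nat).
Implicit Types (q : mpoly.mpoly N R) (x v : 'rV[R]_N).

Lemma mpoly_ring_ind (P : mpoly.mpoly N R -> Prop) :
  (forall c, P (mpolyC N c)) -> (forall i, P (mpolyX R (mnm1 i))) ->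
  (forall p q, P p -> P q -> P (p + q)) -> (forall p q, P p -> P q -> P (p * q)) ->
  forall q, P q.
Proof.
move=> PC PX PD PM q; rewrite (mpolyE q).
apply: big_ind => [||a _]; [by rewrite -mpolyC0|exact: PD|].
rewrite -mul_mpolyC mpolyXE_id; apply: (PM); first exact: PC.
apply: big_ind => [||i _]; [by rewrite -mpolyC1|exact: PM|].
by elim: (a i) => [|k IHk]; rewrite ?expr0 -?mpolyC1// exprS; apply: (PM).
Qed.

Lemma differentiable_meval q x : differentiable (fun y : 'rV[R]_N => meval (y 0) q) x.
Proof.
elim/mpoly_ring_ind: q => [c|i|p q dp dq|p q dp dq].
- by under eq_fun do rewrite mevalC; exact: differentiable_cst.
- by under eq_fun do rewrite mevalXU; exact: differentiable_coord.
- by under eq_fun do rewrite mevalD; exact: differentiableD.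
- by under eq_fun do rewrite mevalM; exact: differentiableM.
Qed.

Lemma derive_meval q x v :
  'D_v (fun y : 'rV[R]_N => meval (y 0) q) x = (line (x 0) (v 0) q)`_1.
Proof.
set L := line _ _ q.
have dL := is_derive_poly L 0; have := @derive_val _ _ _ _ _ _ _ dL.
rewrite horner_coef0 coef_deriv mulr1n => <-; rewrite /derive.
do 2!f_equal; apply/funext => h /=.
congr (_ *: (_ - _)).
  by rewrite horner_line; apply: meval_eq => i; rewrite !mxE addr0 /GRing.scale/= mulr1 addrC.
by rewrite horner_coef0 line_coef0.
Qed.

Variables (f : 'rV[R]_N -> 'rV[R]_N) (F : 'I_N -> mpoly.mpoly N R).
Hypothesis fE : forall x k, f x 0 k = meval (x 0) (F k).

Lemma differentiable_polymap x : differentiable f x.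
Proof.
have -> : f = \sum_(k < N) (fun y : 'rV[R]_N => meval (y 0) (F k) *: delta_mx 0 k).
  apply/funext => y; rewrite [LHS]row_sum_delta fct_sumE.
  by apply: eq_bigr => k _; rewrite fE.
by apply: differentiable_sum => k; apply/differentiableZl/differentiable_meval.
Qed.

Lemma mul_jacobian_polymap x v k :
  (v *m jacobian f x) 0 k = (line (x 0) (v 0) (F k))`_1.
Proof.
rewrite mul_rV_lin1 -deriveE; last exact: differentiable_polymap.
rewrite derive_mx; last exact/diff_derivable/differentiable_polymap.
rewrite mxE -derive_meval; congr ('D_v _ x).
by apply/funext => y; rewrite fE.
Qed.

Lemma det_jacobian_surj x : \det (jacobian f x) != 0 ->
  forall u : 'I_N -> R, exists v : 'I_N -> R, forall k, (line (x 0) v (F k))`_1 = u k.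
Proof.
move=> J0 u; have Ju : jacobian f x \in unitmx by rewrite unitmxE unitfE.
exists ((\row_k u k *m invmx (jacobian f x)) 0) => k.
by rewrite -mul_jacobian_polymap mulmxKV// mxE.
Qed.

Lemma det_jacobian_inj x :
  (forall v, (forall k, (line (x 0) (v 0) (F k))`_1 = 0) -> v = 0) ->
  \det (jacobian f x) != 0.
Proof.
move=> inj; rewrite -unitfE -unitmxE -row_free_unit -kermx_eq0.
apply/eqP/row_matrixP => i; rewrite row0; apply: inj => k.
by rewrite -mul_jacobian_polymap -row_mul mulmx_ker !mxE.
Qed.

End PolynomialMaps.

(** * Coordinates of the phase space *)

Section Coordinates.
Variable R : realType.

Lemma vcons0 m (x : R) (v : 'rV[R]_m) : vcons x v 0 ord0 = x.
Proof.
have -> : ord0 = lshift m (ord0 : 'I_1) :> 'I_(1 + m) by exact: val_inj.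
by rewrite [LHS]row_mxEl mxE eqxx mulr1n.
Qed.

Lemma vconsS m (x : R) (v : 'rV[R]_m) i : vcons x v 0 (lift ord0 i) = v 0 i.
Proof.
have -> : lift ord0 i = rshift 1 i :> 'I_(1 + m) by exact: val_inj.
by rewrite [LHS]row_mxEr.
Qed.

Lemma vtailE m (v : 'rV[R]_m.+1) i : vtail v 0 i = v 0 (lift ord0 i).
Proof. by rewrite mxE. Qed.

Variable d : nat.

Lemma cyl0 theta (v : 'rV[R]_d.+1) : cyl theta v 0 ord0 = v 0 ord0 * cos theta.
Proof. by rewrite /cyl vcons0. Qed.

Lemma cyl1 theta (v : 'rV[R]_d.+1) : cyl theta v 0 (lift ord0 ord0) = v 0 ord0 * sin theta.
Proof. by rewrite /cyl vconsS vcons0. Qed.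

Lemma cylS theta (v : 'rV[R]_d.+1) l :
  cyl theta v 0 (lift ord0 (lift ord0 l)) = v 0 (lift ord0 l).
Proof. by rewrite /cyl !vconsS vtailE. Qed.

End Coordinates.

(** * Primitives of polynomials *)

Section Antiderivative.
Variable R : numFieldType.

Definition antideriv (p : {poly R}) : {poly R} :=
  \sum_(i < size p) (p`_i / i.+1%:R) *: 'X^(i.+1).

Lemma antiderivK p : (antideriv p)^`() = p.
Proof.
rewrite /antideriv raddf_sum/= -[RHS]coefK poly_def; apply: eq_bigr => i _.
by rewrite derivZ derivXn -[X in _ *: X = _]scaler_nat scalerA divfK// pnatr_eq0.
Qed.

End Antiderivative.

(** * Trigonometric integrals over a period *)

Section TrigonometricIntegrals.
Variable R : realType.
Implicit Types (f g : R -> R) (i j : nat).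

Definition period_int f : R := \int[lebesgue_measure]_(theta in `[0, 2 * pi]) f theta.

Lemma integrable_period f : continuous f ->
  (lebesgue_measure : {measure set (measurableTypeR R) -> \bar R}).-integrable
    (`[0, 2 * pi] : set (measurableTypeR R)) (EFin \o f).
Proof.
move=> cf; apply: continuous_compact_integrable; first exact: segment_compact.
exact: continuous_subspaceT.
Qed.

Lemma period_intD f g : continuous f -> continuous g ->
  period_int (fun t => f t + g t) = period_int f + period_int g.
Proof. by move=> cf cg; apply: RintegralD => //; exact: integrable_period. Qed.

Lemma period_intZ c f : continuous f -> period_int (fun t => c * f t) = c * period_int f.
Proof. by move=> cf; apply: RintegralZl => //; exact: integrable_period. Qed.

Lemma period_int_cst c : period_int (fun=> c) = 2 * pi * c.
Proof.
rewrite /period_int Rintegral_cst//= lebesgue_measure_itv/= lte_fin.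
by rewrite pmulr_rgt0// pi_gt0 oppr0 addr0 mulrC.
Qed.

Lemma continuous_mulf f g : continuous f -> continuous g -> continuous (fun t => f t * g t).
Proof. by move=> cf cg t; apply: cvgM; [exact: cf|exact: cg]. Qed.

Lemma continuous_sumf (I : Type) (s : seq I) (F : I -> R -> R) :
  (forall k, continuous (F k)) -> continuous (fun t => \sum_(k <- s) F k t).
Proof.
move=> cF; elim: s => [|k s IHs].
  by under eq_fun do rewrite big_nil; move=> t; exact: cvg_cst.
by under eq_fun do rewrite big_cons; move=> t; apply: continuousD; [exact: cF|exact: IHs].
Qed.

Lemma period_int_sum (I : Type) (s : seq I) (F : I -> R -> R) : (forall k, continuous (F k)) ->
  period_int (fun t => \sum_(k <- s) F k t) = \sum_(k <- s) period_int (F k).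
Proof.
move=> cF; elim: s => [|k s IHs].
  under [X in period_int X]eq_fun do rewrite big_nil.
  by rewrite period_int_cst mulr0 big_nil.
under [X in period_int X]eq_fun do rewrite big_cons.
by rewrite period_intD ?IHs ?big_cons//; exact: continuous_sumf.
Qed.

Lemma period_int_periodic_deriv (F f : R -> R) : (forall t : R, is_derive t 1 F (f t)) ->
  continuous f -> F (2 * pi) = F 0 -> period_int f = 0.
Proof.
move=> dF cf F2pi; have pi2 : (0 : R) < 2 * pi by rewrite pmulr_rgt0// pi_gt0.
have cF t : {for t, continuous F}.
  by apply/differentiable_continuous/derivable1_diffP; case: (dF t).
rewrite /period_int /Rintegral (@continuous_FTC2 _ _ F)//.
- by rewrite -EFinB/= F2pi subrr.
- exact: continuous_subspaceT.
- split=> [t _||].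
  + by case: (dF t).
  + by apply: cvg_at_right_filter; exact: cF.
  + by apply: cvg_at_left_filter; exact: cF.
- by move=> t _; rewrite derive1E; apply: derive_val.
Qed.

Definition trig_mono i j (t : R) : R := cos t ^+ i * sin t ^+ j.

Lemma continuous_trig_mono i j : continuous (trig_mono i j).
Proof.
apply: continuous_mulf => t.
  exact: (continuous_comp (@continuous_cos R t) (@exprn_continuous _ i _)).
exact: (continuous_comp (@continuous_sin R t) (@exprn_continuous _ j _)).
Qed.

(** Such a monomial has a periodic primitive, namely a polynomial in [sin] or in [cos]. *)
Lemma period_int_trig_mono_odd i j : odd i || odd j -> period_int (trig_mono i j) = 0.
Proof.
case/orP => [oi|oj].
  pose Q := antideriv ((1 - 'X^2) ^+ i./2 * 'X^j : {poly R}).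
  apply: (@period_int_periodic_deriv (horner Q \o sin)); last 2 first.
  - exact: continuous_trig_mono.
  - by rewrite /= mulr_natl sin2pi sin0.
  move=> t; have := is_derive1_comp (is_derive_poly Q (sin t)) (is_derive_sin t).
  rewrite antiderivK; congr is_derive.
  rewrite !hornerE -cos2sin2 /trig_mono -exprM.
  by rewrite -[in RHS](odd_double_half i) oi add1n exprS -mul2n mulnC; ring.
pose Q := antideriv ((1 - 'X^2) ^+ j./2 * 'X^i : {poly R}).
apply: (@period_int_periodic_deriv (horner (- Q) \o cos)); last 2 first.
- exact: continuous_trig_mono.
- by rewrite /= mulr_natl cos2pi cos0.
move=> t; have := is_derive1_comp (is_derive_poly (- Q) (cos t)) (is_derive_cos t).
rewrite derivN antiderivK; congr is_derive.
rewrite !hornerE -sin2cos2 /trig_mono -exprM.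
by rewrite -[in RHS](odd_double_half j) oj add1n exprS -mul2n mulnC; ring.
Qed.

End TrigonometricIntegrals.

(** * The averaged function as a polynomial map *)

Section AveragedMonomials.
Variables (R : realType) (d : nat).
Implicit Types (q : mpoly.mpoly d.+2 R) (v : 'rV[R]_d.+1) (a : multinom d.+2).

Definition rdeg a := (a ord0 + a (lift ord0 ord0))%N.

(** The monomial in [(r, z)] that a monomial in [(x, y, z)] becomes once the trigonometric
    factors are integrated, divided by [r ^ e]. *)
Definition polar_exponent e a : multinom d.+1 :=
  Multinom [tuple (if unlift ord0 k is Some l then a (lift ord0 (lift ord0 l))
                   else rdeg a - e)%N | k < d.+1].

(** The integral over a period of [cos ^ i * sin ^ j * q], divided by [r ^ e]. *)
Definition averaged_mpoly i j e q : mpoly.mpoly d.+1 R :=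
  \sum_(a <- msupp q) (mcoeff a q * period_int (@trig_mono R (a ord0 + i) (a (lift ord0 ord0) + j)))
     *: mpolyX R (polar_exponent e a).

Lemma polar_exponent0 e a : polar_exponent e a ord0 = (rdeg a - e)%N.
Proof. by rewrite multinomE tnth_mktuple unlift_none. Qed.

Lemma polar_exponentS e a l : polar_exponent e a (lift ord0 l) = a (lift ord0 (lift ord0 l)).
Proof. by rewrite multinomE tnth_mktuple liftK. Qed.

Lemma mdeg_polar_exponent e a : (e <= rdeg a)%N ->
  (mdeg (polar_exponent e a) + e = mdeg a)%N.
Proof.
move=> ea; rewrite !mdegE !big_ord_recl polar_exponent0 addnAC subnK// -addnA.
by congr (_ + (_ + _))%N; apply: eq_bigr => l _; rewrite polar_exponentS.
Qed.

Lemma peval_cyl q theta v : peval q (cyl theta v) =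
  \sum_(a <- msupp q) mcoeff a q * (v 0 ord0 ^+ rdeg a
     * \prod_l v 0 (lift ord0 l) ^+ a (lift ord0 (lift ord0 l)))
     * @trig_mono R (a ord0) (a (lift ord0 ord0)) theta.
Proof.
rewrite /peval mevalE; apply: eq_bigr => a _; rewrite -mulrA; congr (_ * _).
rewrite !big_ord_recl cyl0 cyl1 !exprMn exprD /trig_mono.
under [in LHS]eq_bigr do rewrite cylS.
by ring.
Qed.

(** Both exponents of a surviving trigonometric factor are even, so that [rdeg a] has the parity
    of [i + j]; when [i + j = 1] it is odd, hence positive, and the subtraction in
    [polar_exponent] does not truncate. *)
Lemma polar_parity i j a :
  period_int (@trig_mono R (a ord0 + i) (a (lift ord0 ord0) + j)) != 0 ->
  (i + j <= 1)%N -> (i + j <= rdeg a)%N /\ ~~ odd (rdeg a - (i + j)).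
Proof.
move=> nz ij; have := contraNF (fun h => introT eqP (@period_int_trig_mono_odd R _ _ h)) nz.
by move=> /norP[]; rewrite /rdeg !oddD; lia.
Qed.

Lemma period_int_peval_cyl i j q v : (i + j <= 1)%N ->
  period_int (fun t => @trig_mono R i j t * peval q (cyl t v)) =
  v 0 ord0 ^+ (i + j) * meval (v 0) (averaged_mpoly i j (i + j) q).
Proof.
move=> ij.
pose coef a := mcoeff a q * (v 0 ord0 ^+ rdeg a
  * \prod_l v 0 (lift ord0 l) ^+ a (lift ord0 (lift ord0 l))).
have -> : (fun t => @trig_mono R i j t * peval q (cyl t v)) =
    (fun t => \sum_(a <- msupp q) coef a * @trig_mono R (a ord0 + i) (a (lift ord0 ord0) + j) t).
  apply/funext => t; rewrite peval_cyl mulr_sumr; apply: eq_bigr => a _.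
  by rewrite /coef /trig_mono !exprD; ring.
rewrite period_int_sum; last first.
  by move=> a; apply: continuous_mulf; [move=> t; exact: cvg_cst|exact: continuous_trig_mono].
rewrite /averaged_mpoly rmorph_sum mulr_sumr; apply: eq_bigr => a _ /=.
rewrite period_intZ; last exact: continuous_trig_mono.
rewrite mevalZ mevalX big_ord_recl polar_exponent0.
under [in RHS]eq_bigr do rewrite polar_exponentS.
have [->|/polar_parity/(_ ij)[ea _]] :=
  eqVneq (period_int (@trig_mono R (a ord0 + i) (a (lift ord0 ord0) + j))) 0.
  by rewrite !(mulr0, mul0r).
by rewrite /coef -[in LHS](subnKC ea) exprD; ring.
Qed.

Lemma msize_averaged_mpoly i j n q : (i + j <= 1)%N -> (mmeasure mdeg q <= n.+1)%N ->
  (mmeasure mdeg (averaged_mpoly i j (i + j) q) <= (n - (i + j)).+1)%N.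
Proof.
move=> ij qn; apply: leq_trans (mmeasure_sum _ _ _ _) _.
rewrite big_seq; apply/bigmax_leqP_seq => a aq _.
have [->|/polar_parity/(_ ij)[ea _]] :=
  eqVneq (period_int (@trig_mono R (a ord0 + i) (a (lift ord0 ord0) + j))) 0.
  by rewrite mulr0 scale0r mmeasure0.
apply: leq_trans (mmeasureZ_le _ _ _) _; rewrite mmeasureX ltnS leq_subRL.
  by rewrite addnC mdeg_polar_exponent// -ltnS (leq_trans _ qn)// msize_mdeg_lt.
rewrite (leq_trans ea)// -ltnS (leq_trans _ qn)//.
by apply: leq_ltn_trans (msize_mdeg_lt aq); rewrite mdegE !big_ord_recl /rdeg addnA leq_addr.
Qed.

Definition reflect_r (x : 'I_d.+1 -> R) k := if k == ord0 then - x k else x k.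

Lemma meval_averaged_mpoly_reflect i j q x : (i + j <= 1)%N ->
  meval (reflect_r x) (averaged_mpoly i j (i + j) q) = meval x (averaged_mpoly i j (i + j) q).
Proof.
move=> ij; rewrite !rmorph_sum; apply: eq_bigr => a _ /=; rewrite !mevalZ !mevalX.
have [->|/polar_parity/(_ ij)[_ even_a]] :=
  eqVneq (period_int (@trig_mono R (a ord0 + i) (a (lift ord0 ord0) + j))) 0.
  by rewrite mulr0 !mul0r.
congr (_ * _); apply: eq_bigr => k _; rewrite /reflect_r; case: eqP => [->|//].
by rewrite polar_exponent0 exprNn -signr_odd (negbTE even_a) mul1r.
Qed.

Variable P : perturbation R d.

(** The averaged function with the factor [r] removed from its first component. *)
Definition reduced_averaged (k : 'I_d.+1) : mpoly.mpoly d.+1 R :=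
  if unlift ord0 k is Some l then averaged_mpoly 0 0 0 (pert_c P l)
  else averaged_mpoly 1 0 1 (pert_a P) + averaged_mpoly 0 1 1 (pert_b P).

Definition averaged_mpolys (k : 'I_d.+1) : mpoly.mpoly d.+1 R :=
  (if k == ord0 then mpolyX R (mnm1 ord0) else 1) * reduced_averaged k.

Lemma continuous_peval_cyl q v : continuous (fun t => peval q (cyl t v)).
Proof.
under eq_fun do rewrite peval_cyl.
apply: continuous_sumf => a; apply: continuous_mulf; last exact: continuous_trig_mono.
by move=> t; exact: cvg_cst.
Qed.

Lemma averagedE v k : averaged P v 0 k = meval (v 0) (averaged_mpolys k).
Proof.
rewrite mxE -/(period_int _) /averaged_mpolys rmorphM/= /reduced_averaged.
case: (unliftP ord0 k) => [l ->|->].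
  rewrite /= rmorph1 mul1r.
  have := period_int_peval_cyl (i := 0) (j := 0) (pert_c P l) v (leqnSn 0).
  rewrite expr0 mul1r => <-; congr period_int; apply/funext => t.
  by rewrite /first_order vconsS mxE /trig_mono !expr0 !mul1r.
rewrite /= mevalXU mevalD mulrDr.
have := period_int_peval_cyl (i := 1) (j := 0) (pert_a P) v (leqnn 1); rewrite expr1 => <-.
have := period_int_peval_cyl (i := 0) (j := 1) (pert_b P) v (leqnn 1); rewrite expr1 => <-.
rewrite -period_intD; last 2 first.
- by apply: continuous_mulf; [exact: continuous_trig_mono|exact: continuous_peval_cyl].
- by apply: continuous_mulf; [exact: continuous_trig_mono|exact: continuous_peval_cyl].
congr period_int; apply/funext => t.
by rewrite /first_order vcons0 /trig_mono !expr0 !expr1 mulr1 mul1r.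
Qed.

End AveragedMonomials.

(** * The upper bound *)

Section UpperBound.
Variables (R : realType) (d n : nat) (P : perturbation R d).
Hypothesis Pn : pert_deg_le n P.
Let G := reduced_averaged P.

Lemma msize_reduced_averaged k :
  (mmeasure mdeg (G k) <= (if k == ord0 then n - 1 else n).+1)%N.
Proof.
case: Pn => an bn cn; rewrite /G /reduced_averaged.
case: (unliftP ord0 k) => [l ->|->] /=.
  by have := @msize_averaged_mpoly R d 0 0 n _ isT (cn l); rewrite subn0.
apply: leq_trans (mmeasureD_le _ _ _) _; rewrite geq_max.
by rewrite (@msize_averaged_mpoly R d 1 0 n _ isT an) (@msize_averaged_mpoly R d 0 1 n _ isT bn).
Qed.

Lemma meval_reduced_reflect x k : meval (reflect_r x) (G k) = meval x (G k).
Proof.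
rewrite /G /reduced_averaged; case: unliftP => [l _|_].
  exact: (@meval_averaged_mpoly_reflect R d 0 0).
rewrite !mevalD; congr (_ + _).
  exact: (@meval_averaged_mpoly_reflect R d 1 0).
exact: (@meval_averaged_mpoly_reflect R d 0 1).
Qed.

Lemma line_coef1M N (p v : 'I_N -> R) q1 q2 : (line p v (q1 * q2))`_1 =
  meval p q1 * (line p v q2)`_1 + (line p v q1)`_1 * meval p q2.
Proof.
have -> : line p v (q1 * q2) = line p v q1 * line p v q2 by exact: rmorphM.
by rewrite coefM !big_ord_recl big_ord0 addr0 /= !line_coef0.
Qed.

(** The reflected zeros inherit nondegeneracy, since reflecting a line does not change the
    restriction of an even polynomial to it. *)
Lemma line_reflect (p v : 'I_d.+1 -> R) k :
  line (reflect_r p) (reflect_r v) (G k) = line p v (G k).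
Proof.
apply/eqP; rewrite -subr_eq0; apply/eqP/poly_vanishing => t.
rewrite hornerD hornerN !horner_line; apply/eqP; rewrite subr_eq0; apply/eqP.
rewrite -meval_reduced_reflect; apply: meval_eq => i; rewrite /reflect_r.
by case: eqP => _; ring.
Qed.

Variable x : 'rV[R]_d.+1.
Hypothesis simple_x : simple_zeros (averaged P) x.

Lemma simple_zero_reduced k : meval (x 0) (G k) = 0.
Proof.
case: simple_x => x0 fx _; have := averagedE P x k.
rewrite fx mxE /averaged_mpolys rmorphM/=; case: eqP => [->|_] /esym/eqP.
  by rewrite mevalXU mulf_eq0 gt_eqF//= => /eqP.
by rewrite rmorph1 mul1r => /eqP.
Qed.

(** At a zero, dividing the first component by [r] divides the first row of the differential
    by [r]. *)
Lemma simple_zero_reduced_surj (u : 'I_d.+1 -> R) :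
  exists v, forall k, (line (x 0) v (G k))`_1 = u k.
Proof.
case: simple_x => x0 _ detx.
have [v vE] := det_jacobian_surj (averagedE P) detx
   (fun k => (if k == ord0 then x 0 ord0 else 1) * u k).
exists v => k; have := vE k; rewrite line_coef1M simple_zero_reduced mulr0 addr0.
case: eqP => [->|_].
  by rewrite mevalXU => /mulfI; apply; rewrite gt_eqF.
by rewrite rmorph1 !mul1r.
Qed.

End UpperBound.

Section UpperBoundCard.
Variables (R : realType) (d n : nat) (P : perturbation R d).
Hypothesis Pn : pert_deg_le n P.

(** The reduced system is even in [r], so every simple zero is accompanied by its mirror image
    with [r < 0], and Bezout's bound counts both. *)
Lemma simple_zeros_double m (q : 'I_m -> 'rV[R]_d.+1) : injective q ->
  (forall i, simple_zeros (averaged P) (q i)) -> (m + m <= n ^ d * (n - 1))%N.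
Proof.
move=> q_inj sq.
pose pt (i : 'I_(m + m)) : 'I_d.+1 -> R :=
  match fintype.split i with inl j => q j 0 | inr j => reflect_r (q j 0) end.
have q0 i : 0 < q i 0 ord0 by case: (sq i).
have qP i j : q i 0 =1 q j 0 -> i = j.
  by move=> E; apply: q_inj; apply/rowP => k; exact: E.
have := @bezout R d.+1 (m + m) pt (reduced_averaged P)
  (fun k => if k == ord0 then (n - 1)%N else n) (msize_reduced_averaged Pn).
rewrite big_ord_recl/= [X in (_ * X)%N](_ : _ = n ^ d)%N; last first.
  by rewrite (eq_bigr (fun=> n))// prod_nat_const card_ord.
rewrite mulnC; apply.
- move=> i j; rewrite /pt.
  case: (split_ordP i) => i' ->; case: (split_ordP j) => j' -> E.
  + by rewrite (qP _ _ E).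
  + have := E ord0; rewrite /reflect_r eqxx => E0.
    by have := q0 i'; rewrite E0 oppr_gt0 ltNge ltW.
  + have := E ord0; rewrite /reflect_r eqxx => E0.
    by have := q0 j'; rewrite -E0 oppr_gt0 ltNge ltW.
  + rewrite (qP i' j')// => k.
    by have := E k; rewrite /reflect_r; case: eqP => // _ /oppr_inj.
- move=> i k; rewrite /pt; case: (fintype.split i) => j; last rewrite meval_reduced_reflect.
    exact: simple_zero_reduced.
  exact: simple_zero_reduced.
- move=> i u; rewrite /pt; case: (fintype.split i) => j.
    exact: simple_zero_reduced_surj.
  have [v vE] := simple_zero_reduced_surj (sq j) u.
  by exists (reflect_r v) => k; rewrite line_reflect.
Qed.

Lemma card_le_or_gt (T : Type) (A : set T) K : A #<= `I_K \/ `I_K.+1 #<= A.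
Proof.
have [/finite_setP[k Ak]|/infiniteP natA] := pselect (finite_set A).
  have [kK|Kk] := leqP k K; [left|right].
    by rewrite (card_le_eql Ak) card_le_II.
  by rewrite (card_le_eqr Ak) card_le_II.
by right; apply: card_le_trans natA; exact: card_leT.
Qed.

Lemma simple_zeros_upper_bound :
  simple_zeros (averaged P) #<= `I_((n ^ d * (n - 1)) %/ 2)%N.
Proof.
have [//|/pcard_leP[f]] := card_le_or_gt (simple_zeros (averaged P)) ((n ^ d * (n - 1)) %/ 2).
set K := (_ %/ 2)%N in f *.
have := @simple_zeros_double K.+1 (fun i => f i); rewrite addnn -muln2 => K2.
have /K2 : injective (fun i : 'I_K.+1 => f i).
  by move=> i j fij; apply/val_inj/(@inj _ _ _ f) => //; rewrite inE /=.
suff : forall i : 'I_K.+1, simple_zeros (averaged P) (f i).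
  by move=> sf /(_ sf); rewrite -leq_divRL// ltnn.
by move=> i; exact: (@funS _ _ _ _ f (i : nat) (ltn_ord i)).
Qed.

End UpperBoundCard.

(** * Polynomials with roots 1, ..., k *)

Section Ladder.
Variable R : realType.

(** Integer roots give explicit gaps: distinct roots are at distance at least one, and no root is
    smaller than one. *)
Definition ladder k : {poly R} := \prod_(i < k) ('X - i.+1%:R%:P).

Lemma ladder_root k x : (ladder k).[x] = 0 -> exists i : 'I_k, x = i.+1%:R.
Proof.
move/eqP; rewrite horner_prod => /prodf_eq0[i _].
by rewrite hornerXsubC subr_eq0 => /eqP ->; exists i.
Qed.

Lemma ladder_natE k (i : 'I_k) : (ladder k).[i.+1%:R] = 0.
Proof. by rewrite horner_prod (bigD1 i)//= hornerXsubC subrr mul0r. Qed.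

Lemma ladder_root_ge1 k x : (ladder k).[x] = 0 -> 1 <= x.
Proof. by move=> /ladder_root[i ->]; rewrite ler1n. Qed.

Lemma ladder_root_isolated k x y : (ladder k).[x] = 0 -> (ladder k).[y] = 0 ->
  `|x - y| < 1 -> x = y.
Proof.
move=> /ladder_root[i ->] /ladder_root[j ->] ij; congr (_%:R).
have gap (a b : nat) : (a < b)%N -> 1 <= b%:R - a%:R :> R.
  by move=> ab; rewrite lerBrDr addrC natr1 ler_nat.
have [/gap ltij|/gap ltji|//] := ltngtP i.+1 j.+1; exfalso.
  by move: ij; rewrite distrC ltNge => /negP; apply; exact: le_trans ltij (ler_norm _).
by move: ij; rewrite ltNge => /negP; apply; exact: le_trans ltji (ler_norm _).
Qed.

Lemma ladder_root_simple k x : (ladder k).[x] = 0 -> (ladder k)^`().[x] != 0.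
Proof.
move=> /ladder_root[i ->]; rewrite /ladder (bigD1 i)//= derivM derivXsubC mul1r.
rewrite hornerD hornerM hornerXsubC subrr mul0r addr0 horner_prod.
apply/prodf_neq0 => j ij; rewrite hornerXsubC subr_eq0 eqr_nat eqSS eq_sym.
by apply: contra_neq ij => /val_inj ->.
Qed.

Definition ladder_mpoly N k (q : mpoly.mpoly N R) : mpoly.mpoly N R :=
  \prod_(i < k) (q - mpolyC N i.+1%:R).

Lemma meval_ladder N k (q : mpoly.mpoly N R) x :
  meval x (ladder_mpoly k q) = (ladder k).[meval x q].
Proof.
rewrite rmorph_prod horner_prod; apply: eq_bigr => i _.
by rewrite /= mevalB mevalC hornerXsubC.
Qed.

Lemma msize_ladder N k (q : mpoly.mpoly N R) e : (mmeasure mdeg q <= e.+1)%N ->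
  (mmeasure mdeg (ladder_mpoly k q) <= (k * e).+1)%N.
Proof.
move=> qe; rewrite -[X in (X * e)%N]card_ord -sum_nat_const.
apply: msize_prod_leq => i _; apply: leq_trans (mmeasureD_le _ _ _) _.
by rewrite geq_max qe mmeasureN msizeC; case: (_ != 0).
Qed.

Lemma line_ladder_coef1 N k (q : mpoly.mpoly N R) p v :
  (line p v (ladder_mpoly k q))`_1 = (ladder k)^`().[meval p q] * (line p v q)`_1.
Proof.
have -> : line p v (ladder_mpoly k q) = ladder k \Po line p v q.
  rewrite [LHS]rmorph_prod [RHS]rmorph_prod; apply: eq_bigr => i _ /=.
  by rewrite rmorphB/= mmapC comp_polyB comp_polyX comp_polyC.
have coef1 (f : {poly R}) : f`_1 = f^`().[0] by rewrite horner_coef0 coef_deriv mulr1n.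
by rewrite !coef1 deriv_comp hornerM horner_comp (horner_coef0 (line p v q)) line_coef0.
Qed.

Lemma line_coef1X N (p v : 'I_N -> R) i : (line p v (mpolyX R (mnm1 i)))`_1 = v i.
Proof. by rewrite /line mmapX mmap1U coefD coefC coefZ coefX mulr1 add0r. Qed.

Lemma msizeXU N (i : 'I_N) : mmeasure mdeg (mpolyX R (mnm1 i)) = 2.
Proof. by rewrite msizeX mdeg1. Qed.

End Ladder.

(** * A perturbation that attains the bound *)

Section Extremal.
Variables (R : realType) (d n : nat) (i0 : 'I_d).

(** The parity of [n] decides which variable each equation uses: the degree [n - 1] left for
    the radial equation is even for odd [n] and can be spent on [s = r ^ 2]; for even [n] it is
    spent on the height [z i0], and [s] moves to the equation of [z i0]. *)
Definition nradii := n./2.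
Definition nheights (l : 'I_d) := if (l == i0) && ~~ odd n then n.-1 else n.

Definition radial_rate (s : R) (z : 'I_d -> R) : R :=
  if odd n then (ladder R nradii).[s] else (ladder R (nheights i0)).[z i0].

(** The summand [ladder (z l)] is kept at [l = i0] even when the radial equation depends on
    [z i0]: it does not change the zeros, and it is the damping that rules out centers. *)
Definition height_rate (s : R) (z : 'I_d -> R) (l : 'I_d) : R :=
  (ladder R (nheights l)).[z l]
  + (if (l == i0) && ~~ odd n then (ladder R nradii).[s] else 0).

(** The two rates, generic in the polynomials for [s] and [z] because they are used both in the
    phase space and in the [(r, z)]-space. *)
Definition radial_mpoly N (S : mpoly.mpoly N R) (Z : 'I_d -> mpoly.mpoly N R) :=
  if odd n then ladder_mpoly nradii S else ladder_mpoly (nheights i0) (Z i0).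

Definition height_mpoly N (S : mpoly.mpoly N R) (Z : 'I_d -> mpoly.mpoly N R) l :=
  ladder_mpoly (nheights l) (Z l)
  + (if (l == i0) && ~~ odd n then ladder_mpoly nradii S else 0).

Lemma meval_radial N (S : mpoly.mpoly N R) Z x :
  meval x (radial_mpoly S Z) = radial_rate (meval x S) (fun l => meval x (Z l)).
Proof. by rewrite /radial_mpoly /radial_rate; case: ifP => _; rewrite meval_ladder. Qed.

Lemma meval_height N (S : mpoly.mpoly N R) Z l x :
  meval x (height_mpoly S Z l) = height_rate (meval x S) (fun l => meval x (Z l)) l.
Proof.
rewrite /height_mpoly /height_rate mevalD meval_ladder; congr (_ + _).
by case: ifP => _; rewrite ?meval_ladder ?meval0.
Qed.

Lemma nradii_double : (nradii * 2 + odd n = n)%N.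
Proof. by rewrite muln2 addnC odd_double_half. Qed.

Lemma nheights_le l : (nheights l <= n)%N.
Proof. by rewrite /nheights; case: ifP => // _; exact: leq_pred. Qed.

Hypothesis n_gt0 : (0 < n)%N.

Lemma msize_radial N (S : mpoly.mpoly N R) Z : (mmeasure mdeg S <= 3)%N ->
  (forall l, mmeasure mdeg (Z l) <= 2)%N -> (mmeasure mdeg (radial_mpoly S Z) <= n)%N.
Proof.
move=> S2 Z1; rewrite /radial_mpoly; have := nradii_double; case: ifP => on n2.
  by apply: leq_trans (msize_ladder _ S2) _; rewrite -[leqRHS]n2 addn1.
apply: leq_trans (msize_ladder _ (Z1 i0)) _.
by rewrite /nheights eqxx on muln1 prednK.
Qed.

Lemma msize_height N (S : mpoly.mpoly N R) Z l : (mmeasure mdeg S <= 3)%N ->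
  (forall l, mmeasure mdeg (Z l) <= 2)%N -> (mmeasure mdeg (height_mpoly S Z l) <= n.+1)%N.
Proof.
move=> S2 Z1; apply: leq_trans (mmeasureD_le _ _ _) _; rewrite geq_max.
rewrite (leq_trans (msize_ladder _ (Z1 l))) ?muln1 ?ltnS ?nheights_le//=.
case: ifP => _; last by rewrite mmeasure0.
by apply: leq_trans (msize_ladder _ S2) _; rewrite ltnS -[leqRHS]nradii_double leq_addr.
Qed.

Let X : mpoly.mpoly d.+2 R := mpolyX R (mnm1 ord0).
Let Y : mpoly.mpoly d.+2 R := mpolyX R (mnm1 (lift ord0 ord0)).
Let Z l : mpoly.mpoly d.+2 R := mpolyX R (mnm1 (lift ord0 (lift ord0 l))).

Definition extremal : perturbation R d :=
  Perturbation (X * radial_mpoly (X ^+ 2 + Y ^+ 2) Z) (Y * radial_mpoly (X ^+ 2 + Y ^+ 2) Z)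
    (height_mpoly (X ^+ 2 + Y ^+ 2) Z).

Lemma extremal_deg : pert_deg_le n extremal.
Proof.
have S2 : (mmeasure mdeg (X ^+ 2 + Y ^+ 2) <= 3)%N.
  apply: leq_trans (mmeasureD_le _ _ _) _; rewrite geq_max.
  by rewrite !(@msizeXn_leq _ _ _ 1 2)// msizeXU.
have Z1 l : (mmeasure mdeg (Z l) <= 2)%N by rewrite msizeXU.
have deg_mul N (q g : mpoly.mpoly N R) : (mmeasure mdeg q <= 2)%N ->
    (mmeasure mdeg g <= n)%N -> deg_le n (q * g).
  by move=> q1; have := msizeM_leq (b := n.-1) q1; rewrite prednK// add1n prednK//; apply.
split=> [||l]; rewrite /deg_le.
- by apply: deg_mul; rewrite ?msizeXU ?msize_radial.
- by apply: deg_mul; rewrite ?msizeXU ?msize_radial.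
- exact: msize_height.
Qed.

Definition sq_radius (q : 'rV[R]_d.+2) := q 0 ord0 ^+ 2 + q 0 (lift ord0 ord0) ^+ 2.
Definition heights (q : 'rV[R]_d.+2) (l : 'I_d) := q 0 (lift ord0 (lift ord0 l)).

Lemma peval_extremal_a q :
  peval (pert_a extremal) q = q 0 ord0 * radial_rate (sq_radius q) (heights q).
Proof.
rewrite /peval mevalM mevalXU meval_radial mevalD !rmorphXn /= !mevalXU.
by congr (_ * radial_rate _ _); apply/funext => l; rewrite mevalXU.
Qed.

Lemma peval_extremal_b q :
  peval (pert_b extremal) q = q 0 (lift ord0 ord0) * radial_rate (sq_radius q) (heights q).
Proof.
rewrite /peval mevalM mevalXU meval_radial mevalD !rmorphXn /= !mevalXU.
by congr (_ * radial_rate _ _); apply/funext => l; rewrite mevalXU.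
Qed.

Lemma peval_extremal_c q l :
  peval (pert_c extremal l) q = height_rate (sq_radius q) (heights q) l.
Proof.
rewrite /peval meval_height mevalD !rmorphXn /= !mevalXU.
by congr (height_rate _ _ _); apply/funext => l'; rewrite mevalXU.
Qed.

Definition zcoord (v : 'rV[R]_d.+1) (l : 'I_d) := v 0 (lift ord0 l).

Lemma sq_radius_cyl t (v : 'rV[R]_d.+1) : sq_radius (cyl t v) = v 0 ord0 ^+ 2.
Proof. by rewrite /sq_radius cyl0 cyl1 !exprMn -mulrDr cos2Dsin2 mulr1. Qed.

Lemma heights_cyl t (v : 'rV[R]_d.+1) : heights (cyl t v) = zcoord v.
Proof. by apply/funext => l; rewrite /heights cylS. Qed.

(** The factor [x, y] in front of the radial rate makes the perturbation equivariant under
    rotations, so that averaging has nothing to do. *)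
Lemma first_order_extremal t v : first_order extremal t v =
  vcons (v 0 ord0 * radial_rate (v 0 ord0 ^+ 2) (zcoord v))
        (\row_l height_rate (v 0 ord0 ^+ 2) (zcoord v) l).
Proof.
rewrite /first_order; congr vcons.
  rewrite peval_extremal_a peval_extremal_b sq_radius_cyl heights_cyl cyl0 cyl1.
  by rewrite -[RHS]mul1r -(cos2Dsin2 t); ring.
by apply/rowP => l; rewrite !mxE peval_extremal_c sq_radius_cyl heights_cyl.
Qed.

Lemma averaged_extremal v : averaged extremal v = (2 * pi) *:
  vcons (v 0 ord0 * radial_rate (v 0 ord0 ^+ 2) (zcoord v))
        (\row_l height_rate (v 0 ord0 ^+ 2) (zcoord v) l).
Proof.
apply/rowP => k; rewrite mxE [RHS]mxE -period_int_cst; congr period_int.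
by apply/funext => t; rewrite first_order_extremal.
Qed.

Definition grid_zero (v : 'rV[R]_d.+1) :=
  (ladder R nradii).[v 0 ord0 ^+ 2] = 0 /\ forall l, (ladder R (nheights l)).[zcoord v l] = 0.

Lemma grid_zero_radial v : grid_zero v -> radial_rate (v 0 ord0 ^+ 2) (zcoord v) = 0.
Proof. by case=> rv zv; rewrite /radial_rate; case: ifP. Qed.

Lemma grid_zero_height v l : grid_zero v -> height_rate (v 0 ord0 ^+ 2) (zcoord v) l = 0.
Proof. by case=> rv zv; rewrite /height_rate zv add0r; case: ifP. Qed.

Lemma first_order_grid_zero t v : grid_zero v -> first_order extremal t v = 0.
Proof.
move=> gv; rewrite first_order_extremal (grid_zero_radial gv) mulr0.
apply/rowP => k; case: (unliftP ord0 k) => [l ->|->]; rewrite ?vcons0 ?vconsS !mxE//.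
exact: grid_zero_height.
Qed.

Lemma averaged_eq0_grid_zero (v : 'rV[R]_d.+1) :
  0 < v 0 ord0 -> averaged extremal v = 0 -> grid_zero v.
Proof.
move=> v0 /eqP; rewrite averaged_extremal scaler_eq0 mulf_eq0 pnatr_eq0/=.
rewrite gt_eqF ?pi_gt0//= => /eqP fv.
have rad : radial_rate (v 0 ord0 ^+ 2) (zcoord v) = 0.
  have := congr1 (fun w : 'rV_d.+1 => w 0 ord0) fv; rewrite vcons0 mxE => /eqP.
  by rewrite mulf_eq0 gt_eqF//= => /eqP.
have hgt l : height_rate (v 0 ord0 ^+ 2) (zcoord v) l = 0.
  by have := congr1 (fun w : 'rV_d.+1 => w 0 (lift ord0 l)) fv; rewrite vconsS !mxE.
move: rad (hgt i0); rewrite /radial_rate /height_rate eqxx /=.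
case: ifPn => on /= rad; last rewrite rad add0r => radii.
  by split=> // l; have := hgt l; rewrite /height_rate on andbF addr0.
split=> // l; have := hgt l; rewrite /height_rate.
by have [->//|] := eqVneq l i0; rewrite /= addr0.
Qed.

Let X' : mpoly.mpoly d.+1 R := mpolyX R (mnm1 ord0).
Let Z' l : mpoly.mpoly d.+1 R := mpolyX R (mnm1 (lift ord0 l)).

Definition extremal_averaged_mpoly (k : 'I_d.+1) : mpoly.mpoly d.+1 R :=
  mpolyC _ (2 * pi) * (if unlift ord0 k is Some l then height_mpoly (X' ^+ 2) Z' l
                       else X' * radial_mpoly (X' ^+ 2) Z').

Lemma averaged_extremal_mpoly v k :
  averaged extremal v 0 k = meval (v 0) (extremal_averaged_mpoly k).
Proof.
rewrite averaged_extremal mxE /extremal_averaged_mpoly mevalM mevalC; congr (_ * _).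
have ZE : (fun l => meval (v 0) (Z' l)) = zcoord v.
  by apply/funext => l; rewrite mevalXU.
case: (unliftP ord0 k) => [l ->|->].
  by rewrite vconsS mxE meval_height ZE rmorphXn/= mevalXU.
by rewrite vcons0 mevalM meval_radial ZE rmorphXn/= mevalXU.
Qed.

(** Up to a permutation of rows the Jacobian matrix is triangular, and its diagonal consists of
    derivatives of ladders at simple roots, up to nonzero factors; the proof solves the
    corresponding linear system. *)
Lemma grid_zero_simple (v : 'rV[R]_d.+1) :
  0 < v 0 ord0 -> grid_zero v -> simple_zeros (averaged extremal) v.
Proof.
move=> v0 gv; split=> //.
  rewrite averaged_extremal (grid_zero_radial gv) mulr0.
  apply/rowP => k; case: (unliftP ord0 k) => [l ->|->]; rewrite mxE ?vcons0 ?vconsS !mxE ?mulr0//.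
  by rewrite grid_zero_height// mulr0.
apply: (det_jacobian_inj averaged_extremal_mpoly) => w w0.
have [rv zv] := gv.
have pi2 : 2 * pi != 0 :> R by rewrite mulf_neq0 ?pnatr_eq0// gt_eqF ?pi_gt0.
have lineE q : (line (v 0) (w 0) (mpolyC d.+1 (2 * pi) * q))`_1 = 0 -> (line (v 0) (w 0) q)`_1 = 0.
  rewrite line_coef1M mevalC /line mmapC coefC /= mul0r addr0 => /eqP.
  by rewrite mulf_eq0 (negbTE pi2) => /eqP.
have radii_neq0 := ladder_root_simple rv.
have height_neq0 l := ladder_root_simple (zv l).
have X2 : meval (v 0) (X' ^+ 2) = v 0 ord0 ^+ 2 by rewrite rmorphXn/= mevalXU.
have lineS : (line (v 0) (w 0) (ladder_mpoly nradii (X' ^+ 2)))`_1 = 0 -> w 0 ord0 = 0.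
  rewrite line_ladder_coef1 X2 => /eqP; rewrite mulf_eq0 (negbTE radii_neq0)/=.
  rewrite expr2 line_coef1M mevalXU line_coef1X mulrC -mulrDr mulf_eq0 => /orP[/eqP//|].
  by rewrite gt_eqF// addr_gt0.
have lineZ l : (line (v 0) (w 0) (ladder_mpoly (nheights l) (Z' l)))`_1 = 0 ->
    w 0 (lift ord0 l) = 0.
  rewrite line_ladder_coef1 mevalXU line_coef1X => /eqP.
  by rewrite mulf_eq0 (negbTE (height_neq0 l)) => /eqP.
have line_hgt l : (line (v 0) (w 0) (height_mpoly (X' ^+ 2) Z' l))`_1 = 0.
  by apply: lineE; have := w0 (lift ord0 l); rewrite /extremal_averaged_mpoly liftK.
have line_rad : (line (v 0) (w 0) (radial_mpoly (X' ^+ 2) Z'))`_1 = 0.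
  have := w0 ord0; rewrite /extremal_averaged_mpoly unlift_none => /lineE.
  have ZE : (fun l => meval (v 0) (Z' l)) = zcoord v by apply/funext => l; rewrite mevalXU.
  rewrite line_coef1M meval_radial ZE X2 grid_zero_radial// mulr0 addr0 mevalXU => /eqP.
  by rewrite mulf_eq0 gt_eqF//= => /eqP.
have w_ord0_lift : w 0 ord0 = 0 -> (forall l, w 0 (lift ord0 l) = 0) -> w = 0.
  move=> w_0 w_l; apply/rowP => k; rewrite mxE.
  by case: (unliftP ord0 k) => [l ->|->].
have line0 : line (v 0) (w 0) 0 = 0 by exact: raddf0.
have lineD (q1 q2 : mpoly.mpoly d.+1 R) :
  line (v 0) (w 0) (q1 + q2) = line (v 0) (w 0) q1 + line (v 0) (w 0) q2 by exact: raddfD.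
move: line_rad line_hgt; rewrite /radial_mpoly /height_mpoly; case: ifPn => on line_rad line_hgt.
  apply: w_ord0_lift => [|l]; first exact: lineS.
  by apply: lineZ; have := line_hgt l; rewrite andbF addr0.
have w_l l : w 0 (lift ord0 l) = 0.
  have [->|ll0] := eqVneq l i0; first exact: lineZ.
  by apply: lineZ; have := line_hgt l; rewrite (negbTE ll0)/= addr0.
apply: w_ord0_lift => //; apply: lineS.
by have := line_hgt i0; rewrite eqxx/= lineD coefD line_rad add0r.
Qed.

End Extremal.

(** * The number of zeros of the extremal perturbation *)

Section ExtremalCount.
Variables (R : realType) (d n : nat) (i0 : 'I_d).
Hypothesis n_gt0 : (0 < n)%N.

Let grid := ('I_(nradii n) * {dffun forall l : 'I_d, 'I_(nheights n i0 l)})%type.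

Lemma card_grid : #|{: grid}| = ((n ^ d * (n - 1)) %/ 2)%N.
Proof.
rewrite card_prod card_ord card_dep_ffun foldrE big_map big_enum /=.
under eq_bigr do rewrite card_ord.
rewrite (bigD1 i0)//= (eq_bigr (fun=> n)); last first.
  by move=> l /negbTE l0; rewrite /nheights l0.
have -> : (\prod_(l < d | l != i0) n = n ^ d.-1)%N.
  by rewrite prod_nat_const; congr expn; rewrite cardC1 card_ord.
have d_gt0 : (0 < d)%N by exact: leq_ltn_trans (leq0n i0) (ltn_ord i0).
have n2 := nradii_double n.
suff -> : (n ^ d * (n - 1) = nradii n * (nheights n i0 i0 * n ^ d.-1) * 2)%N by rewrite mulnK.
rewrite -[in LHS](prednK d_gt0) expnS /nheights eqxx/= subn1.
move: n2; case: ifPn => [/negbTE on|/negbNE on]; rewrite on ?addn0 ?addn1 => n2; last first.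
  by rewrite -[in (n.-1)%N]n2 /=; nia.
by rewrite -[in X in (X * _ * _)%N]n2; nia.
Qed.

Definition grid_point (x : grid) : 'rV[R]_d.+1 :=
  vcons (Num.sqrt x.1.+1%:R) (\row_l (x.2 l).+1%:R).

Lemma grid_point0 x : grid_point x 0 ord0 = Num.sqrt x.1.+1%:R.
Proof. exact: vcons0. Qed.

Lemma zcoord_grid_point x l : zcoord (grid_point x) l = (x.2 l).+1%:R.
Proof. by rewrite /zcoord vconsS mxE. Qed.

Lemma grid_point_simple x : simple_zeros (averaged (extremal R n i0)) (grid_point x).
Proof.
apply: grid_zero_simple; first by rewrite grid_point0 sqrtr_gt0 ltr0n.
split=> [|l]; last by rewrite zcoord_grid_point ladder_natE.
by rewrite grid_point0 sqr_sqrtr ?ler0n// ladder_natE.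
Qed.

Lemma grid_point_inj : injective grid_point.
Proof.
move=> [i f] [j h] E; congr pair.
  have := congr1 (fun v : 'rV_d.+1 => v 0 ord0) E; rewrite !grid_point0 => /eqP.
  by rewrite eqr_sqrt ?ler0n// eqr_nat eqSS => /eqP/val_inj.
apply/ffunP => l; have := congr1 (fun v : 'rV_d.+1 => zcoord v l) E.
by rewrite /= !zcoord_grid_point => /eqP; rewrite eqr_nat eqSS => /eqP/val_inj.
Qed.

Lemma card_extremal_ge :
  `I_((n ^ d * (n - 1)) %/ 2)%N #<= simple_zeros (averaged (extremal R n i0)).
Proof.
rewrite -card_grid.
pose F k : 'rV[R]_d.+1 :=
  if (insub k : option 'I_#|{: grid}|) is Some o then grid_point (enum_val o) else 0.
have FE k (lt_k : (k < #|{: grid}|)%N) : F k = grid_point (enum_val (Ordinal lt_k)).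
  by rewrite /F insubT.
have F_inj : {in `I_#|{: grid}| &, injective F}.
  move=> i j; rewrite !inE/= => lti ltj; rewrite !FE => /grid_point_inj/enum_val_inj.
  by case.
rewrite -(card_le_eql (inj_card_eq F_inj)).
by apply: subset_card_le => _ [k /= lt_k <-]; rewrite FE; exact: grid_point_simple.
Qed.

Lemma card_extremal :
  simple_zeros (averaged (extremal R n i0)) #= `I_((n ^ d * (n - 1)) %/ 2)%N.
Proof.
rewrite card_eq_le card_extremal_ge andbT.
exact: simple_zeros_upper_bound (extremal_deg R i0 n_gt0).
Qed.

End ExtremalCount.

(** * Differentiable curves *)

Section RealCurves.
Variable R : realType.
Implicit Types (f g : R -> R) (t a b : R).

Lemma is_derive_mul f g t a b : is_derive t 1 f a -> is_derive t 1 g b ->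
  is_derive t 1 (fun u => f u * g u) (a * g t + f t * b).
Proof.
by move=> df dg; apply: (is_derive_eq (is_deriveM df dg)); rewrite /GRing.scale/=; ring.
Qed.

Lemma is_derive_add f g t a b : is_derive t 1 f a -> is_derive t 1 g b ->
  is_derive t 1 (fun u => f u + g u) (a + b).
Proof. by move=> df dg; exact: is_deriveD. Qed.

Lemma is_derive_fsum (I : finType) (F : I -> R -> R) t (a : I -> R) :
  (forall i, is_derive t 1 (F i) (a i)) -> is_derive t 1 (fun u => \sum_i F i u) (\sum_i a i).
Proof.
move=> dF; have -> : (fun u => \sum_i F i u) = \sum_i F i by apply/funext => u; rewrite fct_sumE.
elim/big_ind2 : _ => // [|f a' g b' df dg]; first exact: is_derive_cst.
exact: is_deriveD.
Qed.

Lemma is_derive_row N (g : R -> 'rV[R]_N) V t :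
  is_derive t 1 g V <-> forall i, is_derive t 1 (fun u => g u 0 i) (V 0 i).
Proof.
split=> [dg i|dg].
  have gt1 : derivable g t 1 by case: dg.
  apply: DeriveDef; first exact: (derivable_mxP g t 1).1.
  have -> : V = 'D_1 g t by rewrite derive_val.
  by rewrite derive_mx// mxE.
have gt1 : derivable g t 1.
  by apply/derivable_mxP => i j; rewrite (ord1 i); case: (dg j).
apply: DeriveDef => //; rewrite derive_mx//; apply/rowP => j; rewrite mxE.
by have dgj := dg j; rewrite derive_val.
Qed.

Lemma is_derive_cst_eq0 f c t a : is_derive t 1 f a -> (forall u, f u = c) -> a = 0.
Proof.
move=> df fc; have fE : f = cst c by apply/funext => u; rewrite fc.
by rewrite -(@derive_val _ _ _ _ _ _ _ df) fE derive_cst.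
Qed.

Lemma is_derive_ge0_le f (a : R -> R) x y : (forall t : R, is_derive t 1 f (a t)) ->
  (forall t, 0 <= a t) -> x <= y -> f x <= f y.
Proof.
move=> df a0 xy; apply: (@ger0_derive1_ndecr _ f x y) => //.
- by move=> t _; have dft := df t; rewrite derive1E derive_val.
- apply: continuous_subspaceT => t.
  by apply/differentiable_continuous/derivable1_diffP; case: (df t).
Qed.

(** A function that is monotone and periodic is constant: this is how a Lyapunov function
    excludes periodic orbits. *)
Lemma periodic_monotone_stationary f (Q : R -> R) (e T : R) : e != 0 -> 0 < T ->
  (forall t : R, is_derive t 1 f (e * Q t)) -> (forall t, 0 <= Q t) ->
  (forall t, f (t + T) = f t) -> forall t, Q t = 0.
Proof.
move=> e0 T0 df Q0 fT t.
pose h u := e * f u.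
have dh (u : R) : is_derive u 1 h (e ^+ 2 * Q u).
  apply: (is_derive_eq (is_derive_mul (is_derive_cst e u 1) (df u))).
  by rewrite /cst; ring.
have h_le x y : x <= y -> h x <= h y.
  by apply: is_derive_ge0_le dh _ => u; rewrite mulr_ge0 ?sqr_ge0.
have hT k u : h (u + k%:R * T) = h u.
  elim: k u => [|k IHk] u; first by rewrite mul0r addr0.
  by rewrite -natr1 mulrDl mul1r addrA {1}/h fT -/(h _) IHk.
have h_const x y : x <= y -> h x = h y.
  move=> xy; apply/eqP; rewrite eq_le h_le//=.
  pose k := Num.Def.archi_bound ((y - x) / T).
  have yk : y <= x + k%:R * T.
    rewrite -lerBlDl -ler_pdivrMr// ltW// archi_boundP// divr_ge0 ?subr_ge0//.
    exact: ltW.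
  by rewrite -(hT k x) h_le.
have h_cst u : h u = h 0.
  by have [/h_const|/ltW/h_const] := leP u 0.
have /eqP := is_derive_cst_eq0 (dh t) h_cst.
by rewrite mulf_eq0 sqrf_eq0 (negbTE e0) => /eqP.
Qed.

Lemma polar_angle r x y : 0 < r -> x ^+ 2 + y ^+ 2 = r ^+ 2 ->
  exists phi : R, x = r * cos phi /\ y = r * sin phi.
Proof.
move=> r0 xy; have r_neq0 : r != 0 by rewrite gt_eqF.
have xr : -1 <= x / r <= 1.
  rewrite ler_pdivlMr// ler_pdivrMr// mulN1r mul1r -ler_norml.
  rewrite -(@ler_pXn2r _ 2) ?nnegrE ?normr_ge0 ?(ltW r0)//.
  by rewrite real_normK ?num_real// -xy lerDl sqr_ge0.
have cosx : x = r * cos (acos (x / r)).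
  by rewrite acosK ?in_itv//= mulrCA mulfV// mulr1.
have siny : r * sin (acos (x / r)) = `|y|.
  rewrite sin_acos// -[X in X * _ = _](ger0_norm (ltW r0)) -sqrtr_sqr -sqrtrM ?sqr_ge0//.
  rewrite -sqrtr_sqr; congr Num.sqrt.
  have rx : r ^+ 2 * (x / r) ^+ 2 = x ^+ 2 by rewrite -exprMn mulrC divfK.
  by rewrite mulrBr mulr1 rx -xy addrAC subrr add0r.
have [y0|y0] := leP 0 y.
  by exists (acos (x / r)); rewrite siny ger0_norm.
exists (- acos (x / r)); rewrite cosN sinN mulrN siny ltr0_norm//.
by rewrite opprK.
Qed.

Lemma rotation_flow (x y : R -> R) r : 0 < r ->
  (forall t : R, is_derive t 1 x (- y t)) -> (forall t : R, is_derive t 1 y (x t)) ->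
  x 0 ^+ 2 + y 0 ^+ 2 = r ^+ 2 ->
  exists phi : R, forall t, x t = r * cos (t + phi) /\ y t = r * sin (t + phi).
Proof.
move=> r0 dx dy xy; have [phi [x0E y0E]] := polar_angle r0 xy.
(* The coordinates in the frame that rotates with the flow are constant. *)
pose u t := x t * cos t + y t * sin t.
pose w t := y t * cos t + - (x t * sin t).
have uE t : u t = x 0.
  have -> : x 0 = u 0 by rewrite /u cos0 sin0 mulr1 mulr0 addr0.
  apply: is_derive_0_is_cst => s; apply: (is_derive_eq (is_derive_add
    (is_derive_mul (dx s) (is_derive_cos s)) (is_derive_mul (dy s) (is_derive_sin s)))).
  by ring.
have wE t : w t = y 0.
  have -> : y 0 = w 0 by rewrite /w cos0 sin0 mulr1 mulr0 oppr0 addr0.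
  apply: is_derive_0_is_cst => s; apply: (is_derive_eq (is_derive_add
    (is_derive_mul (dy s) (is_derive_cos s))
    (is_deriveN (is_derive_mul (dx s) (is_derive_sin s))))).
  by ring.
exists phi => t; rewrite cosD sinD.
have -> : x t = x 0 * cos t - y 0 * sin t.
  by rewrite -(uE t) -(wE t) /u /w -[LHS]mulr1 -(cos2Dsin2 t); ring.
have -> : y t = x 0 * sin t + y 0 * cos t.
  by rewrite -(uE t) -(wE t) /u /w -[LHS]mulr1 -(cos2Dsin2 t); ring.
by rewrite x0E y0E; split; ring.
Qed.

Lemma near_dist_lt (T : topologicalType) (f : T -> R) q c e : {for q, continuous f} ->
  `|f q - c| < e -> \forall y \near q, `|f y - c| < e.
Proof.
move=> cf; apply: cvgr_lt; apply: cvg_norm; apply: cvgB; [exact: cf|exact: cvg_cst].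
Qed.

End RealCurves.

(** * Periodic orbits of the extremal perturbation *)

Section ExtremalDynamics.
Variables (R : realType) (d n : nat) (i0 : 'I_d).
Let P := extremal R n i0.
Let b := ladder R (nradii n).
Let c l := ladder R (nheights n i0 l).

Lemma vfield_extremal0 e q : vfield P e q 0 ord0 =
  - q 0 (lift ord0 ord0) + e * (q 0 ord0 * radial_rate n i0 (sq_radius q) (heights q)).
Proof. by rewrite /vfield vcons0 peval_extremal_a /vhead vtailE. Qed.

Lemma vfield_extremal1 e q : vfield P e q 0 (lift ord0 ord0) =
  q 0 ord0 + e * (q 0 (lift ord0 ord0) * radial_rate n i0 (sq_radius q) (heights q)).
Proof. by rewrite /vfield vconsS vcons0 peval_extremal_b /vhead. Qed.

Lemma vfield_extremalS e q l : vfield P e q 0 (lift ord0 (lift ord0 l)) =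
  e * height_rate n i0 (sq_radius q) (heights q) l.
Proof. by rewrite /vfield !vconsS mxE peval_extremal_c. Qed.

Lemma unperturbed_orbitE (p : 'rV[R]_d.+1) q : unperturbed_orbit p q <->
  sq_radius q = p 0 ord0 ^+ 2 /\ heights q = zcoord p.
Proof.
rewrite /unperturbed_orbit /= /vhead vtailE; split=> -[sq E]; split=> //.
  by apply/funext => l; rewrite /heights /zcoord -!vtailE E.
by apply/rowP => l; rewrite !vtailE; exact: (congr1 (fun h => h l) E).
Qed.

Lemma polar_orbit_cst (p : 'rV[R]_d.+1) : 0 < p 0 ord0 ->
  polar_orbit (fun=> p) = unperturbed_orbit p.
Proof.
move=> p0; apply/seteqP; split=> [_ [t _ <-]|q].
  by apply/unperturbed_orbitE; rewrite sq_radius_cyl heights_cyl.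
move=> /unperturbed_orbitE[sq hq]; have [phi [xE yE]] := polar_angle p0 sq.
exists phi => //; apply/rowP => k; case: (unliftP ord0 k) => [k' ->|->]; last by rewrite cyl0.
case: (unliftP ord0 k') => [l ->|->]; last by rewrite cyl1.
by rewrite cylS; exact: (esym (congr1 (fun h => h l) hq)).
Qed.

Variables (p : 'rV[R]_d.+1) (e : R).
Hypotheses (p0 : 0 < p 0 ord0) (gp : grid_zero n i0 p) (e_neq0 : e != 0).

Lemma extremal_solution : is_solution (vfield P e) (fun t => cyl t p).
Proof.
move=> t; apply/is_derive_row => k; case: (unliftP ord0 k) => [k' ->|->].
  case: (unliftP ord0 k') => [l ->|->].
    rewrite vfield_extremalS sq_radius_cyl heights_cyl grid_zero_height// mulr0.
    by under eq_fun do rewrite cylS; exact: is_derive_cst.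
  rewrite vfield_extremal1 sq_radius_cyl heights_cyl grid_zero_radial// !mulr0 addr0 cyl0.
  under eq_fun do rewrite cyl1.
  apply: (is_derive_eq (is_derive_mul (is_derive_cst (p 0 ord0) t 1) (is_derive_sin t))).
  by rewrite mul0r add0r.
rewrite vfield_extremal0 sq_radius_cyl heights_cyl grid_zero_radial// !mulr0 addr0 cyl1.
under eq_fun do rewrite cyl0.
apply: (is_derive_eq (is_derive_mul (is_derive_cst (p 0 ord0) t 1) (is_derive_cos t))).
by rewrite mul0r add0r mulrN.
Qed.

Lemma extremal_periodic_orbit : periodic_orbit (vfield P e) (polar_orbit (fun=> p)).
Proof.
exists (fun t => cyl t p); split=> //.
- exact: extremal_solution.
- exists (2 * pi); first by rewrite mulr_gt0 ?pi_gt0.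
  by move=> t; rewrite /cyl mulr_natl cosD2pi sinD2pi.
- exists pi; apply/negP => /eqP/(congr1 (fun q : 'rV_d.+2 => q 0 ord0)).
  rewrite !cyl0 cospi cos0 => /mulfI; rewrite gt_eqF// => /(_ isT) /eqP.
  by rewrite -subr_eq0 -opprD oppr_eq0 gt_eqF.
Qed.

Lemma extremal_polar_solution : polar_periodic_solution P e (fun=> p).
Proof.
move=> t; split=> //.
- rewrite /angular_speed peval_extremal_a peval_extremal_b cyl0 cyl1.
  by rewrite sq_radius_cyl heights_cyl grid_zero_radial// !mulr0 subrr mulr0 mul0r addr0.
- by rewrite first_order_grid_zero// scaler0; exact: is_derive_cst.
Qed.

(** The width one is the gap between the roots of a ladder: the tube contains no other zero of
    [b] or of the [c l], and it stays away from the axis [s = 0]. *)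
Definition tube : set 'rV[R]_d.+2 :=
  [set q | `|sq_radius q - p 0 ord0 ^+ 2| < 1 /\ forall l, `|heights q l - zcoord p l| < 1].

Lemma continuous_coord m (k : 'I_m) : continuous (fun q : 'rV[R]_m => q 0 k).
Proof. by move=> q; apply: differentiable_continuous; exact: differentiable_coord. Qed.

Lemma continuous_sq_radius : continuous (@sq_radius R d).
Proof.
have cX k (q : 'rV[R]_d.+2) : {for q, continuous (fun y : 'rV[R]_d.+2 => y 0 k ^+ 2)}.
  exact: (continuous_comp (@continuous_coord _ k q) (@exprn_continuous _ 2 _)).
by move=> q; exact: (cvgD (cX ord0 q) (cX (lift ord0 ord0) q)).
Qed.

Lemma tube_open : open tube.
Proof.
rewrite openE => q [sq hq]; rewrite /interior.
have near_sq : \forall y \near q, `|sq_radius y - p 0 ord0 ^+ 2| < 1.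
  exact: near_dist_lt (@continuous_sq_radius q) sq.
have near_hq : \forall y \near q, forall l, `|heights y l - zcoord p l| < 1.
  apply: (@filter_forall _ 'I_d (fun l y => `|heights y l - zcoord p l| < 1) (nbhs q) _) => l.
  apply: (near_dist_lt (f := fun y => heights y l)) (hq l).
  exact: continuous_coord.
exact: filterI near_sq near_hq.
Qed.

Lemma orbit_sub_tube : polar_orbit (fun=> p) `<=` tube.
Proof.
rewrite polar_orbit_cst// => q /unperturbed_orbitE[sq hq].
by split=> [|l]; rewrite ?sq ?hq subrr normr0.
Qed.

(** A primitive of [b s / (2 s)], where [b s / s] splits into [b 0 / s] and a polynomial. *)
Definition radial_potential (s : R) : R :=
  (b`_0 * ln s + (antideriv (drop_poly 1 b)).[s]) / 2.

Lemma is_derive_radial_potential (s : R) : 0 < s ->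
  is_derive s 1 radial_potential (b.[s] / (2 * s)).
Proof.
move=> s0.
have dln : is_derive s 1 (fun u => b`_0 * ln u) (b`_0 / s).
  apply: (is_derive_eq (is_derive_mul (is_derive_cst b`_0 s 1) (is_derive1_ln s0))).
  by rewrite mul0r add0r.
have dpoly := is_derive_poly (antideriv (drop_poly 1 b)) s.
have dpot : is_derive s 1 radial_potential _ :=
  is_derive_mul (is_derive_add dln dpoly) (is_derive_cst (2^-1 : R) s 1).
apply: (is_derive_eq dpot); rewrite antiderivK mulr0 addr0.
have -> : b.[s] = b`_0 + (drop_poly 1 b).[s] * s.
  rewrite -[in LHS](poly_take_drop 1 b) expr1 hornerD hornerMX; congr (_ + _).
  rewrite horner_poly big_ord_recl big_ord0 addr0 expr0 mulr1 //.
by rewrite /cst /=; field; rewrite gt_eqF.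
Qed.

(** The sign for even [n] makes the products of [b] and [c i0] that come from the two
    coupled equations cancel. *)
Definition lyapunov (s : R) (z : 'I_d -> R) : R :=
  (if odd n then 1 else -1) * radial_potential s + \sum_l (antideriv (c l)).[z l].

Definition dissipation (s : R) (z : 'I_d -> R) : R :=
  (if odd n then b.[s] ^+ 2 else 0) + \sum_l (c l).[z l] ^+ 2.

Lemma dissipation_eq0 s z : dissipation s z = 0 ->
  (odd n -> b.[s] = 0) /\ forall l, (c l).[z l] = 0.
Proof.
have S0 : 0 <= \sum_l (c l).[z l] ^+ 2 by apply: sumr_ge0 => l _; exact: sqr_ge0.
have B0 : 0 <= (if odd n then b.[s] ^+ 2 else 0) by case: ifP => // _; exact: sqr_ge0.
move=> /eqP; rewrite paddr_eq0// => /andP[/eqP bs /eqP cz]; split.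
  by move=> on; move: bs; rewrite on => /eqP; rewrite sqrf_eq0 => /eqP.
move=> l; have /(_ l isT)/eqP := psumr_eq0P (fun l _ => sqr_ge0 _) cz.
by rewrite sqrf_eq0 => /eqP.
Qed.

(** Decoupled equations contribute the square of their right-hand side. For even [n] the
    equations of [s] and [z i0] are coupled: they form a Hamiltonian system, whose energy is
    the corresponding part of [lyapunov], with the damping term [c i0], whose square is all that
    this pair contributes. *)
Lemma lyapunov_identity s z :
  (if odd n then 1 else -1) * (b.[s] * radial_rate n i0 s z)
  + \sum_l (c l).[z l] * height_rate n i0 s z l = dissipation s z.
Proof.
rewrite /dissipation /radial_rate /height_rate -/b; case: ifPn => on.
  by rewrite mul1r expr2; congr (_ + _); apply: eq_bigr => l _; rewrite andbF addr0 expr2.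
rewrite add0r (bigD1 i0)//= [in RHS](bigD1 i0)//= eqxx /=.
under eq_bigr => l /negbTE l0 do rewrite l0 addr0 -expr2.
by rewrite -/(c i0); ring.
Qed.

(** The squares in [dissipation] are zero along the orbit. This fixes [z], then [s] for odd
    [n]; for even [n] the equation of [z i0], which is now constant, gives [b = 0]. *)
Lemma periodic_in_tube (g : R -> 'rV[R]_d.+2) (T : R) : is_solution (vfield P e) g -> 0 < T ->
  (forall t, g (t + T) = g t) -> (forall t, tube (g t)) ->
  forall t, unperturbed_orbit p (g t).
Proof.
move=> sol T0 gT g_tube.
have dg (t : R) k : is_derive t 1 (fun u => g u 0 k) (vfield P e (g t) 0 k).
  by have /is_derive_row := sol t; apply.
pose s (t : R) := sq_radius (g t); pose z (t : R) := heights (g t).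
have ds (t : R) : is_derive t 1 s (2 * s t * (e * radial_rate n i0 (s t) (z t))).
  have dx := dg t ord0; have dy := dg t (lift ord0 ord0).
  apply: (is_derive_eq (is_derive_add (is_derive_mul dx dx) (is_derive_mul dy dy))).
  by rewrite vfield_extremal0 vfield_extremal1 /s /z /sq_radius; ring.
have dz (t : R) l : is_derive t 1 (fun u => z u l) (e * height_rate n i0 (s t) (z t) l).
  by have := dg t (lift ord0 (lift ord0 l)); rewrite vfield_extremalS.
have [rp zp] := gp.
have s0 t : 0 < s t.
  have := ladder_root_ge1 rp; have [+ _] := g_tube t; rewrite -/(s t) ltr_norml.
  by move=> /andP[]; lra.
have dH (t : R) : is_derive t 1 (fun u => lyapunov (s u) (z u)) (e * dissipation (s t) (z t)).
  have dB := is_derive1_comp (is_derive_radial_potential (s0 t)) (ds t).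
  have dC := is_derive_fsum (fun l =>
    is_derive1_comp (is_derive_poly (antideriv (c l)) (z t l)) (dz t l)).
  have dL : is_derive t 1 (fun u => lyapunov (s u) (z u)) _ :=
    is_derive_add (is_derive_mul (is_derive_cst (if odd n then 1 else -1 : R) t 1) dB) dC.
  apply: (is_derive_eq dL); rewrite -lyapunov_identity [RHS]mulrDr [in RHS]mulr_sumr.
  rewrite mul0r add0r; congr (_ + _).
    by rewrite [RHS]mulrCA; congr (_ * _); field; rewrite gt_eqF.
  by apply: eq_bigr => l _; rewrite antiderivK mulrCA.
have D0 t : dissipation (s t) (z t) = 0.
  apply: (periodic_monotone_stationary e_neq0 T0 dH) => [u|u]; last by rewrite /s /z gT.
  rewrite addr_ge0//; first by case: ifP => // _; exact: sqr_ge0.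
  by apply: sumr_ge0 => l _; exact: sqr_ge0.
have z_cst t l : z t l = zcoord p l.
  have [_ cz] := dissipation_eq0 (D0 t); have [_ /(_ l)] := g_tube t.
  exact: ladder_root_isolated (cz l) (zp l).
move=> t; apply/unperturbed_orbitE; split; last by apply/funext => l; exact: z_cst.
suff bs : b.[s t] = 0.
  by have [+ _] := g_tube t; apply: ladder_root_isolated bs rp.
have [bs cz] := dissipation_eq0 (D0 t); case: (boolP (odd n)) => [/bs//|on].
have /eqP := is_derive_cst_eq0 (dz t i0) (fun u => z_cst u i0).
rewrite mulf_eq0 (negbTE e_neq0)/= /height_rate eqxx on/= => /eqP.
by have := cz i0; rewrite /c => ->; rewrite add0r.
Qed.

(** On the cylinder of the given orbit the radial rate vanishes and the flow is a rotation, so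
    that every orbit in it is the whole circle. *)
Lemma extremal_limit_cycle : limit_cycle (vfield P e) (polar_orbit (fun=> p)).
Proof.
split; first exact: extremal_periodic_orbit.
exists tube; split; [exact: tube_open|exact: orbit_sub_tube|].
move=> _ [g [sol [T T0 gT] _ ->]] g_sub.
have g_orbit t : unperturbed_orbit p (g t).
  by apply: (periodic_in_tube sol T0 gT) => u; apply: g_sub; exists u.
have dg (t : R) k : is_derive t 1 (fun u => g u 0 k) (vfield P e (g t) 0 k).
  by have /is_derive_row := sol t; apply.
have rad t : radial_rate n i0 (sq_radius (g t)) (heights (g t)) = 0.
  by have /unperturbed_orbitE[-> ->] := g_orbit t; exact: grid_zero_radial.
have dx (t : R) : is_derive t 1 (fun u => g u 0 ord0) (- g t 0 (lift ord0 ord0)).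
  by have := dg t ord0; rewrite vfield_extremal0 rad !mulr0 addr0.
have dy (t : R) : is_derive t 1 (fun u => g u 0 (lift ord0 ord0)) (g t 0 ord0).
  by have := dg t (lift ord0 ord0); rewrite vfield_extremal1 rad !mulr0 addr0.
have /unperturbed_orbitE[sq0 _] := g_orbit 0.
have [phi gE] := rotation_flow p0 dx dy sq0.
have cylE t : g t = cyl (t + phi) p.
  have [xE yE] := gE t; have /unperturbed_orbitE[_ hE] := g_orbit t.
  apply/rowP => k; case: (unliftP ord0 k) => [k' ->|->]; last by rewrite cyl0.
  case: (unliftP ord0 k') => [l ->|->]; last by rewrite cyl1.
  by rewrite cylS; exact: (congr1 (fun h => h l) hE).
apply/seteqP; split=> _ [t _ <-].
  by exists (t + phi) => //; rewrite cylE.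
by exists (t - phi) => //; rewrite cylE subrK.
Qed.

End ExtremalDynamics.

Theorem theorem1 (R : realType) (d n : nat) (hd : (1 <= d)%N) (hn : (1 <= n)%N) :
  (forall P : perturbation R d, pert_deg_le n P ->
     simple_zeros (averaged P) #<= `I_((n ^ d * (n - 1)) %/ 2)%N) /\
  (exists P : perturbation R d,
     [/\ pert_deg_le n P,
         simple_zeros (averaged P) #= `I_((n ^ d * (n - 1)) %/ 2)%N
       & exists w : R -> 'rV[R]_d.+1 -> R -> 'rV[R]_d.+1,
           (\forall e \near (0 : R)^',
              (forall p, simple_zeros (averaged P) p ->
                 polar_periodic_solution P e (w e p) /\
                 limit_cycle (vfield P e) (polar_orbit (w e p))) /\
              set_inj (simple_zeros (averaged P)) (fun p => polar_orbit (w e p))) /\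
           (forall p, simple_zeros (averaged P) p ->
              w e p 0 @[e --> (0 : R)^'] --> p /\
              hausdorff_cvg0 (fun e => polar_orbit (w e p)) (unperturbed_orbit p))]).
Proof.
split; first by move=> P; exact: simple_zeros_upper_bound.
pose i0 : 'I_d := Ordinal hd; pose P := extremal R n i0.
have grid p : simple_zeros (averaged P) p -> 0 < p 0 ord0 /\ grid_zero n i0 p.
  by case=> p0 fp _; split=> //; exact: averaged_eq0_grid_zero.
exists P; split; [exact: extremal_deg|exact: card_extremal|].
exists (fun _ p _ => p); split; last first.
  move=> p /grid[p0 _]; split; first exact: cvg_cst.
  rewrite polar_orbit_cst// => delta delta0; apply: nearW => _.
  by split=> q Oq; exists q => //; exact: ballxx.
near=> e; have e_neq0 : e != 0 by near: e; exact: nbhs_dnbhs_neq.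
split=> [p /grid[p0 gp]|p q].
  by split; [exact: extremal_polar_solution|exact: extremal_limit_cycle].
move=> /set_mem/grid[p0 _] /set_mem/grid[q0 _] /=.
rewrite !polar_orbit_cst// => E.
have : unperturbed_orbit q (cyl 0 p).
  by rewrite -E; apply/unperturbed_orbitE; rewrite sq_radius_cyl heights_cyl.
move=> /unperturbed_orbitE; rewrite sq_radius_cyl heights_cyl => -[r2 z2].
apply/rowP => k; case: (unliftP ord0 k) => [l ->|->].
  exact: (congr1 (fun h => h l) z2).
by apply: (pexpIrn (n := 2)) r2; rewrite // nnegrE ltW.
Unshelve. all: by end_near. Qed.
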